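(* Let $R$ be a commutative Noetherian $\mathbb{N}$-graded ring, let $M$ be a finitely generated $\mathbb{Z}$-graded $R$-module, and let $N$ be a graded submodule of $M$. Let $I_1,\dots,I_r$ be homogeneous ideals of $R$, set $\mathbf{I}:=I_1\cdots I_r$, and $\mathbf{I}^{\underline{n}}:=I_1^{n_1}\cdots I_r^{n_r}$ for $\underline{n}=(n_1,\dots,n_r)\in\mathbb{N}^r$. Then the $v$-number $v(\mathbf{I}^{\underline{n}}M/\mathbf{I}^{\underline{n}}N)$ eventually becomes either $\infty$ or the minimum of finitely many linear functions in $\underline{n}$; that is, either $v(\mathbf{I}^{\underline{n}}M/\mathbf{I}^{\underline{n}}N)=\infty$ for all $\underline{n}\gg\underline{0}$, or there exist finitely many $\underline{w}_1,\dots,\underline{w}_s\in\mathbb{N}^r$ and $c_1,\dots,c_s\in\mathbb{Z}$ with $v(\mathbf{I}^{\underline{n}}M/\mathbf{I}^{\underline{n}}N)=\min\{\underline{w}_k\cdot\underline{n}+c_k:1\le k\le s\}$ for all $\underline{n}\gg\underline{0}$. The same holds for the function $v(M/\mathbf{I}^{\underline{n}}N)$ under the additional conditions that $(0:_M I_k)=0$ for all $k=1,\dots,r$, and $\mathbf{I}^{\underline{s}}M\subseteq N$ for some $\underline{s}\in\mathbb{N}^r$.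
   Context: $\mathbb{N}$ includes $0$. $\mathbb{Z}^r$ is ordered componentwise; $\underline{0}=(0,\dots,0)$; $\underline{m}\cdot\underline{n}=m_1n_1+\cdots+m_rn_r$. A property holds ''for all $\underline{n}\gg\underline{0}$'' (eventually) if there is $\underline{m}\in\mathbb{N}^r$ such that it holds for all $\underline{n}\ge\underline{m}$. $(0:_M I)=\{x\in M:Ix=0\}$. For a finitely generated $\mathbb{Z}$-graded $R$-module $L$ and $\mathfrak{p}\in\operatorname{Ass}_R(L)$, the local $v$-number is $v_{\mathfrak{p}}(L):=\inf\{n\in\mathbb{Z}:\text{there exists }x\in L_n\text{ such that }\mathfrak{p}=(0:_R x)\}$, and the $v$-number (Vasconcelos invariant) is $v(L):=\inf\{v_{\mathfrak{p}}(L):\mathfrak{p}\in\operatorname{Ass}_R(L)\}$, with the convention $v(0)=\infty$. *)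

(* Defs.v *)
From HB Require Import structures.
From mathcomp Require Import all_boot all_order all_algebra.
From mathcomp Require Import all_classical constructive_ereal.

Set Implicit Arguments.
Unset Strict Implicit.
Unset Printing Implicit Defensive.

Import Order.TTheory GRing.Theory Num.Theory.

Local Open Scope classical_set_scope.
Local Open Scope quotient_scope.
Local Open Scope ring_scope.

(* An ideal of R is a submodule of R^o (the library's idealr is restricted to
   proper ideals of nontrivial rings). *)

Section Span.
Variables (R : pzRingType) (V : lmodType R).

Definition span_mod (S : set V) : {pred V} :=
  fun x => `[< forall A : submodClosed V, S `<=` [set` A] -> x \in A >].

Lemma span_mod_closed S : submod_closed (span_mod S).
Proof.
split=> [|a x y /asboolP xS /asboolP yS]; apply/asboolP => A SA.
  exact: rpred0.
by rewrite rpredD ?rpredZ ?xS ?yS.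
Qed.

HB.instance Definition _ S :=
  GRing.isSubmodClosed.Build R V (span_mod S) (span_mod_closed S).

Definition full_mod : {pred V} := predT.

Lemma full_mod_closed : submod_closed full_mod.
Proof. by []. Qed.

HB.instance Definition _ :=
  GRing.isSubmodClosed.Build R V full_mod full_mod_closed.

Definition fin_gen (A : submodClosed V) : Prop :=
  exists s : seq V, A =i span_mod [set` s].

End Span.

Arguments full_mod {R} V _.

Definition noetherian (R : pzRingType) : Prop :=
  forall I : submodClosed R^o, fin_gen I.

Section IdealPower.
Variable R : comPzRingType.

(* The product I A of an ideal and a submodule; for V = R^o, the product of
   two ideals. *)
Definition ideal_mul (V : lmodType R) (I : submodClosed R^o)
    (A : submodClosed V) : submodClosed V :=
  span_mod [set x | exists a y, [/\ a \in I, y \in A & x = (a : R) *: y]].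

Definition ideal_exp (I : submodClosed R^o) (n : nat) : submodClosed R^o :=
  iter n (ideal_mul I) (full_mod R^o).

Definition ideal_mexp (r : nat) (I : 'I_r -> submodClosed R^o)
    (n : 'I_r -> nat) : submodClosed R^o :=
  \big[@ideal_mul R^o/(full_mod R^o : submodClosed R^o)]_(i < r)
    ideal_exp (I i) (n i).

End IdealPower.

Section SubModule.
Variables (R : pzRingType) (V : lmodType R) (A : submodClosed V).

Inductive submod_of : predArgType := SubmodOf x & x \in A.

Definition submod_val u : V := let: SubmodOf x _ := u in x.

Lemma submod_oppr_closed : oppr_closed A.
Proof. by move=> x Ax; rewrite -scaleN1r rpredZ. Qed.

Lemma submod_zmod_closed : zmod_closed A.
Proof.
split=> [|x y Ax Ay]; first exact: rpred0.
by rewrite rpredD ?submod_oppr_closed.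
Qed.

HB.instance Definition _ := [isSub of submod_of for submod_val].
HB.instance Definition _ := [Choice of submod_of by <:].
HB.instance Definition _ :=
  GRing.SubChoice_isSubZmodule.Build V _ submod_of submod_zmod_closed.
HB.instance Definition _ := [SubZmodule_isSubLmodule of submod_of by <:].

End SubModule.

Section QuotientModule.
Variables (R : pzRingType) (V : lmodType R) (B : submodClosed V).

Definition zmod_of_submod : {pred V} := B.

HB.instance Definition _ :=
  GRing.isZmodClosed.Build V zmod_of_submod (submod_zmod_closed B).

Definition quotmod := Quotient.quot zmod_of_submod.

HB.instance Definition _ := GRing.Zmodule.on quotmod.
HB.instance Definition _ := EqQuotient.on quotmod.

Definition quotmod_pi (x : V) : quotmod := \pi_quotmod x.

Definition quotmod_scale (a : R) (u : quotmod) : quotmod :=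
  quotmod_pi (a *: repr u).

Lemma quotmod_piE x y : (quotmod_pi x = quotmod_pi y) <-> (x - y \in B).
Proof. by split=> [/eqP|h]; [|apply/eqP]; rewrite /quotmod_pi -Quotient.idealrBE. Qed.

Lemma quotmod_reprK u : quotmod_pi (repr u) = u.
Proof. exact: reprK. Qed.

Lemma quotmod_piD x y : quotmod_pi (x + y) = quotmod_pi x + quotmod_pi y.
Proof. exact: Quotient.pi_add. Qed.

Lemma quotmod_piZ a x : quotmod_pi (a *: x) = quotmod_scale a (quotmod_pi x).
Proof.
by apply/quotmod_piE; rewrite -scalerBr rpredZ//; apply/quotmod_piE; rewrite quotmod_reprK.
Qed.

Lemma quotmod_scaleA a b u :
  quotmod_scale a (quotmod_scale b u) = quotmod_scale (a * b) u.
Proof. by rewrite -[u]quotmod_reprK -!quotmod_piZ scalerA. Qed.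

Lemma quotmod_scale1 : left_id 1 quotmod_scale.
Proof. by move=> u; rewrite -[u]quotmod_reprK -quotmod_piZ scale1r. Qed.

Lemma quotmod_scaleDr : right_distributive quotmod_scale +%R.
Proof.
move=> a u v; rewrite -[u]quotmod_reprK -[v]quotmod_reprK.
by rewrite -quotmod_piD -!quotmod_piZ scalerDr quotmod_piD.
Qed.

Lemma quotmod_scaleDl u : {morph quotmod_scale^~ u : a b / a + b}.
Proof.
by move=> a b; rewrite -[u]quotmod_reprK -!quotmod_piZ scalerDl quotmod_piD.
Qed.

HB.instance Definition _ := GRing.Zmodule_isLmodule.Build R quotmod
  quotmod_scaleA quotmod_scale1 quotmod_scaleDr quotmod_scaleDl.

Lemma quotmod_pi_is_linear : linear quotmod_pi.
Proof. by move=> a x y; rewrite quotmod_piD quotmod_piZ. Qed.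

HB.instance Definition _ :=
  GRing.isLinear.Build R V quotmod _ quotmod_pi quotmod_pi_is_linear.

End QuotientModule.

Section SubQuotient.
Variables (R : pzRingType) (V : lmodType R) (A B : submodClosed V).

Definition restr_mod : {pred submod_of A} := fun u => val u \in B.

Lemma restr_mod_closed : submod_closed restr_mod.
Proof.
split=> [|a u v uB vB]; first exact: (rpred0 B).
by change (a *: val u + val v \in B); rewrite rpredD ?rpredZ.
Qed.

HB.instance Definition _ :=
  GRing.isSubmodClosed.Build R (submod_of A) restr_mod restr_mod_closed.

(* A / (A :&: B), hence A / B when B is contained in A *)
Definition subquot := quotmod restr_mod.

HB.instance Definition _ := GRing.Lmodule.on subquot.

End SubQuotient.

Arguments restr_mod {R V} A B _.

Section Grading.

Definition decomposes (I : choiceType) (V : zmodType) (gr : I -> {pred V})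
    (f : I -> V) (x : V) : Prop :=
  [/\ forall i, f i \in gr i, finite_set [set i | f i != 0]
    & x = \sum_(i \in [set: I]) f i].

Definition direct_sum (I : choiceType) (V : zmodType) (gr : I -> {pred V}) :=
  (forall i, zmod_closed (gr i)) /\ forall x, exists! f, decomposes gr f x.

Definition ring_grading (R : comPzRingType) (gr : nat -> {pred R}) : Prop :=
  [/\ direct_sum gr, 1 \in gr 0%N
    & forall i j a b, a \in gr i -> b \in gr j -> a * b \in gr (i + j)%N].

Definition module_grading (R : comPzRingType) (V : lmodType R)
    (grR : nat -> {pred R}) (gr : int -> {pred V}) : Prop :=
  direct_sum gr /\
  forall i j a x, a \in grR i -> x \in gr j -> a *: x \in gr (i%:Z + j).

Definition homogeneous (I : choiceType) (V : zmodType) (gr : I -> {pred V})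
    (A : {pred V}) : Prop :=
  forall x, x \in A -> exists2 f, decomposes gr f x & forall i, f i \in A.

Definition sub_gr (I : Type) (R : pzRingType) (V : lmodType R)
    (A : submodClosed V) (gr : I -> {pred V}) (i : I) : {pred submod_of A} :=
  fun u => val u \in gr i.

Definition quot_gr (I : Type) (R : pzRingType) (V : lmodType R)
    (B : submodClosed V) (gr : I -> {pred V}) (i : I) : {pred quotmod B} :=
  fun u => `[< exists2 x, x \in gr i & u = quotmod_pi B x >].

Arguments sub_gr {I R V} A gr i _.
Arguments quot_gr {I R V} B gr i _.

Definition subquot_gr (I : Type) (R : pzRingType) (V : lmodType R)
    (A B : submodClosed V) (gr : I -> {pred V}) (i : I) :
    {pred subquot A B} :=
  quot_gr (restr_mod A B) (sub_gr A gr) i.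

End Grading.

Arguments sub_gr {I R V} A gr i _.
Arguments quot_gr {I R V} B gr i _.
Arguments subquot_gr {I R V} A B gr i _.

Section VNumber.
Variables (R : comPzRingType) (V : lmodType R).

Definition ann (x : V) : {pred R} := fun a => a *: x == 0.

Definition prime_ideal (p : submodClosed R^o) : Prop :=
  1 \notin p /\ forall a b : R, a * b \in p -> a \in p \/ b \in p.

Definition Ass : set (submodClosed R^o) :=
  [set p | prime_ideal p /\ exists x : V, p =i ann x].

Variable gr : int -> {pred V}.

Definition vnum_loc (p : submodClosed R^o) : \bar int :=
  infimum +oo%E
    [set n%:E | n in [set n : int | exists2 x, x \in gr n & p =i ann x]].

Definition vnum : \bar int := infimum +oo%E [set vnum_loc p | p in Ass].

End VNumber.

(* (0 :_V I) *)
Definition zero_colon (R : comPzRingType) (V : lmodType R)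
    (I : submodClosed R^o) : set V :=
  [set x | forall a, a \in I -> (a : R) *: x = 0].

Arguments zero_colon {R} V I _.

Definition eventually (r : nat) (P : ('I_r -> nat) -> Prop) : Prop :=
  exists m : 'I_r -> nat, forall n, (forall i, (m i <= n i)%N) -> P n.

Definition eventually_oo_or_min_linear (r : nat)
    (v : ('I_r -> nat) -> \bar int) : Prop :=
  eventually (fun n => v n = +oo%E) \/
  exists (s : nat) (w : 'I_s.+1 -> 'I_r -> nat) (c : 'I_s.+1 -> int),
    eventually (fun n => v n =
      \big[Order.min/+oo%E]_(k < s.+1)
        ((\sum_(i < r) w k i * n i)%N%:Z + c k)%:E).

(* Main.v *)
Require Import Defs.
From HB Require Import structures.
From mathcomp Require Import all_boot all_order all_algebra.
From mathcomp Require Import all_classical constructive_ereal.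
From mathcomp Require Import zify.
Set Implicit Arguments.
Unset Strict Implicit.
Unset Printing Implicit Defensive.
Import Order.TTheory GRing.Theory Num.Theory.
Local Open Scope classical_set_scope.
Local Open Scope ring_scope.

(** The proof takes place inside M and follows the theory of multigraded modules
    over the multi-Rees ring of I_1, ..., I_r, with explicit families
    n |-> Z n of submodules of M in the place of such modules.

    Fix homogeneous generators g_y of the ideals, g_y belonging to I_(kp y). Then
    I^n Q is spanned by the products of a monomial g^b of multidegree n with an
    element of Q. Filter it by the lexicographically initial exponent. For a family
    Z with I_k Z_n inside Z_(n + e_k), the submodules [lead Q Z a] of M formed by the
    initial coefficients at the exponent a grow with a. As M is Noetherian,
    exponents decompose into finitely many boxes, translates of coordinate faces
    of the orthant, on which the initial coefficients are constant
    ([box_decomposition]). This single fact replaces Hilbert's basis theorem and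
    prime filtrations:

    - such a Z inside (I^n Q) is generated in bounded degrees ([rees_fin_gen]);
    - if T is a subfamily of Z, both of them graded, then Z_n and T_n differ in
      degree d if and only if, for some exponent a of multidegree n, the initial
      coefficients of Z and T at a differ in degree d minus the weight of a. On one
      box the least such d is a linear function of n, or does not exist
      ([min_linear_box]), so the least degree where Z_n and T_n differ is
      eventually a minimum of linear functions ([min_linear_graded]).

    For the quotients I^n Q / I^n P, an associated prime is associated to M modulo
    a module of initial coefficients, and so only finitely many primes occur
    ([Ass_lead], [finite_Ass_mod]). The local v-number at p is the initial degree
    of the part killed by p modulo the part of it that vanishes in the
    localization at p, to which the above applies ([min_linear_prime]). The first
    claim is the case Q = M, P = N.

    For M / I^n N, a prime annihilator of x contains I^(n + s), hence some I_k, so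
    that I_k x lies in I^n N. The Artin-Rees lemma and once more [rees_fin_gen] show that
    for large n this forces x into I^(n - e_k) N ([colon_power]). Therefore the
    v-number is the minimum over k of those of I^(n - e_k) N / I^(n - e_k) (I_k N),
    to which the first part applies. *)

(** * Submodules and products of ideals *)

Section Submodules.
Variables (R : comPzRingType) (V : lmodType R).
Implicit Types (A B : submodClosed V) (S : set V).

(** Equality of bundled submodules makes products of ideals a commutative
    monoid, so that powers with a multiexponent can be handled by big operators. *)
Lemma submod_ext A B : A =i B -> A = B.
Proof.
case: A B => [A [[a] [a']]] [B [[b] [b']]] AB.
have E : A = B by apply/funext => x; exact: AB.
subst B; congr GRing.SubmodClosed.Pack; congr GRing.SubmodClosed.Class.
  by congr GRing.isAddClosed.Axioms_; exact: Prop_irrelevance.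
by congr GRing.isScaleClosed.Axioms_; exact: Prop_irrelevance.
Qed.

Lemma mem_span S x : S x -> x \in span_mod S.
Proof. by move=> Sx; apply/asboolP => A; apply. Qed.

Lemma span_sub S A : S `<=` [set` A] -> {subset span_mod S <= A}.
Proof. by move=> SA x /asboolP; apply. Qed.

Lemma span_ind S (P : V -> Prop) :
  P 0 -> (forall a x y, P x -> P y -> P (a *: x + y)) -> S `<=` P ->
  forall x, x \in span_mod S -> P x.
Proof.
move=> P0 PL SP x.
have cl : submod_closed ((fun x => `[< P x >]) : {pred V}).
  by split=> [|a y z /asboolP Py /asboolP Pz]; apply/asboolP => //; exact: PL.
pose A : submodClosed V := HB.pack_for (submodClosed V)
  ((fun x => `[< P x >]) : {pred V}) (GRing.isSubmodClosed.Build R V _ cl).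
by move=> /(@span_sub S A) -/(_ (fun y Sy => asboolT (SP y Sy))) /asboolP.
Qed.

(** Lets a submodule be introduced by a predicate, as the span of the elements
    that satisfy it. *)
Lemma span_closed (P : set V) :
  P 0 -> (forall a x y, P x -> P y -> P (a *: x + y)) ->
  forall x, x \in span_mod P <-> P x.
Proof. by move=> P0 PL x; split=> [|/mem_span //]; exact: span_ind. Qed.

Lemma span_mono S T : S `<=` T -> {subset span_mod S <= span_mod T}.
Proof. by move=> ST; apply: span_sub => x /ST; exact: mem_span. Qed.

Lemma submodB A x y : x \in A -> y \in A -> x - y \in A.
Proof. by move=> Ax Ay; rewrite -scaleN1r addrC rpredD ?rpredZ. Qed.

Lemma submod_sum A (T : Type) (s : seq T) (P : pred T) (F : T -> V) :
  (forall i, P i -> F i \in A) -> \sum_(i <- s | P i) F i \in A.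
Proof. by move=> h; apply: (big_ind (fun x => x \in A)); [exact: rpred0|exact: rpredD|]. Qed.

End Submodules.

Section Ideals.
Variable R : comPzRingType.
Implicit Types (I J : submodClosed R^o).

Section Mul.
Variable V : lmodType R.
Implicit Types (A B : submodClosed V).

Lemma mem_ideal_mul I A (a : R) x : a \in I -> x \in A -> a *: x \in ideal_mul I A.
Proof. by move=> Ia Ax; apply: mem_span; exists a, x. Qed.

Lemma ideal_mul_sub I A B :
  (forall (a : R) x, a \in I -> x \in A -> a *: x \in B) -> {subset ideal_mul I A <= B}.
Proof. by move=> h; apply: span_sub => _ [a [x [? ? ->]]]; exact: h. Qed.

Lemma ideal_mul_subr I A : {subset ideal_mul I A <= A}.
Proof. by apply: ideal_mul_sub => a x _ Ax; rewrite rpredZ. Qed.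

Lemma ideal_mulS I J A B : {subset I <= J} -> {subset A <= B} ->
  {subset ideal_mul I A <= ideal_mul J B}.
Proof. by move=> IJ AB; apply: ideal_mul_sub => a x /IJ ? /AB ?; exact: mem_ideal_mul. Qed.

Lemma ideal_mul_full A : ideal_mul (full_mod R^o) A = A.
Proof.
apply: submod_ext => x; apply/idP/idP; first exact: ideal_mul_subr.
by move=> Ax; rewrite -[x]scale1r; apply: mem_ideal_mul.
Qed.
End Mul.

Lemma ideal_mulA (V : lmodType R) I J (A : submodClosed V) :
  ideal_mul I (ideal_mul J A) = ideal_mul (ideal_mul I J) A.
Proof.
apply: submod_ext => x; apply/idP/idP; move: x; apply: ideal_mul_sub.
  move=> a x Ia; move: x; apply: span_ind.
  - by rewrite scaler0; exact: rpred0.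
  - by move=> b x y ? ?; rewrite scalerDr scalerA mulrC -scalerA rpredD // rpredZ.
  - move=> _ [b [y [Jb Ay ->]]] /=; rewrite scalerA; apply: mem_ideal_mul => //.
    exact: (@mem_ideal_mul R^o).
move=> a x + Ax; move: a; apply: (@span_ind R R^o).
- by rewrite scale0r; exact: rpred0.
- by move=> b y z ? ?; rewrite scalerDl -scalerA rpredD // rpredZ.
- move=> _ [b [c [Ib Jc ->]]] /=; rewrite -[_ *: x]scalerA.
  by apply: mem_ideal_mul => //; apply: mem_ideal_mul.
Qed.

Lemma ideal_mulC I J : ideal_mul I J = ideal_mul J I.
Proof.
apply: submod_ext => x; apply/idP/idP; move: x; apply: ideal_mul_sub => a x ? ?;
  rewrite [_ *: _]mulrC; exact: (@mem_ideal_mul R^o).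
Qed.

HB.instance Definition _ := Monoid.isComLaw.Build (submodClosed R^o) (full_mod R^o)
  (@ideal_mul R R^o) (@ideal_mulA R^o) ideal_mulC (@ideal_mul_full R^o).

End Ideals.

(** * Noetherian modules *)

Section Noetherian.
Variables (R : comPzRingType) (V : lmodType R).

Lemma span_consP (x : V) (s : seq V) z : z \in span_mod [set` x :: s] ->
  exists a y, y \in span_mod [set` s] /\ z = a *: x + y.
Proof.
move: z; apply: span_ind.
- by exists 0, 0; rewrite scale0r addr0; split=> //; exact: rpred0.
- move=> a _ _ [b [y [sy ->]]] [c [z [sz ->]]]; exists (a * b + c), (a *: y + z).
  split; first by rewrite rpredD ?rpredZ.
  by rewrite scalerDr scalerA scalerDl addrACA.
- move=> y /=; rewrite inE => /orP[/eqP ->|sy].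
    by exists 1, 0; rewrite scale1r addr0; split=> //; exact: rpred0.
  by exists 0, y; rewrite scale0r add0r; split=> //; exact: mem_span.
Qed.

Lemma mem_cap (A B : submodClosed V) z :
  z \in span_mod [set x | x \in A /\ x \in B] <-> z \in A /\ z \in B.
Proof.
apply: span_closed; first by split; exact: rpred0.
by move=> c x y [? ?] [? ?]; split; rewrite rpredD ?rpredZ.
Qed.

(** By induction on the number of generators of the ambient module: the
    coefficients of the first generator in elements of A form an ideal, and once
    they are matched there remains an element of the module on the others. *)
Lemma fin_gen_sub : noetherian R -> fin_gen (full_mod V) ->
  forall A : submodClosed V, fin_gen A.
Proof.
move=> noethR [s0 fs0] A.
have : {subset A <= span_mod [set` s0]} by move=> x _; rewrite -fs0.
elim: s0 A {fs0} => [|x s IH] A As.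
  exists [::] => y; apply/idP/idP => [/As //|]; move: y.
  by apply: span_sub.
have [t Jt] := @noethR (span_mod [set a : R^o |
    exists2 y, y \in span_mod [set` s] & (a : R) *: x + y \in A]).
have JP : forall a : R^o, a \in span_mod [set` t] -> exists2 y, y \in span_mod [set` s] &
    (a : R) *: x + y \in A.
  move=> a; rewrite -Jt => /(@span_closed R R^o); apply.
    by exists 0; rewrite ?scale0r ?addr0; exact: rpred0.
  move=> c b d [y ys Ay] [z zs Az]; exists (c *: y + z); first by rewrite rpredD ?rpredZ.
  by rewrite scalerDl -scalerA addrACA -scalerDr rpredD ?rpredZ.
have /choice[f fP] : forall a : R^o, exists y, a \in span_mod [set` t] ->
    y \in span_mod [set` s] /\ (a : R) *: x + y \in A.
  move=> a; have [/JP[y ys yA]|//] := boolP (a \in span_mod [set` t]).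
    by exists y.
  by exists 0.
have [|s' s'P] := IH (span_mod [set z | z \in A /\ z \in span_mod [set` s]]).
  by move=> z /mem_cap[].
have s'E z : z \in A -> z \in span_mod [set` s] -> z \in span_mod [set` s'].
  by move=> Az sz; rewrite -s'P; apply: mem_span.
pose g (a : R^o) : V := (a : R) *: x + f a.
exists (map g t ++ s') => z; apply/idP/idP.
  move=> Az; have [a [y [sy zE]]] := span_consP (As _ Az).
  have at_ : a \in span_mod [set` t : seq R^o].
    by rewrite -Jt; apply: mem_span; exists y => //; rewrite -zE.
  have [w [Aw tw sw]] : exists w, [/\ w \in A,
      w \in span_mod [set` map g t] & w - a *: x \in span_mod [set` s]].
    move: (a : R^o) at_ {zE}; apply: (@span_ind R R^o).
    - by exists 0; rewrite scale0r subr0; split; exact: rpred0.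
    - move=> c b d [w [Aw tw sw]] [w' [Aw' tw' sw']]; exists (c *: w + w').
      split; [by rewrite rpredD ?rpredZ | by rewrite rpredD ?rpredZ |].
      have -> : (c *: b + d : R) *: x = c *: ((b : R) *: x) + (d : R) *: x.
        by rewrite scalerDl -scalerA.
      by rewrite opprD addrACA -scalerBr rpredD ?rpredZ.
    - move=> b bt; have [] := fP b (mem_span bt); exists (g b); split=> //.
        by apply: mem_span => /=; exact: map_f.
      by rewrite /g addrAC subrr add0r.
  rewrite -[z](subrK w) rpredD //; last first.
    by apply: span_mono tw => v /= vt; rewrite mem_cat vt.
  have : z - w \in span_mod [set` s'].
    apply: s'E; first exact: submodB.
    have -> : z - w = y - (w - a *: x) by rewrite zE opprB addrA [y + _]addrC.
    exact: submodB.
  by apply: span_mono => v /= vt; rewrite mem_cat vt orbT.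
apply: span_sub => v /=; rewrite mem_cat => /orP[/mapP[a at_ ->]|vs'].
  by have [] := fP a (mem_span at_).
have : v \in span_mod [set` s'] by exact: mem_span.
by rewrite -s'P => /mem_cap[].
Qed.

(** Otherwise some strictly increasing sequence in S exists, and the finitely many
    generators of its union already lie in one of its terms. *)
Lemma submod_maximal : (forall A : submodClosed V, fin_gen A) ->
  forall S : set (submodClosed V), S !=set0 ->
  exists2 A, S A & forall B, S B -> {subset A <= B} -> B = A.
Proof.
move=> fg S [A0 SA0]; apply: contrapT => nmax.
have /choice[F FP] : forall A, exists B, S A -> [/\ S B, {subset A <= B} & B <> A].
  move=> A; have [SA|nSA] := pselect (S A); last by exists A.
  apply: contrapT => nB; apply: nmax; exists A => // B SB AB.
  by apply: contrapT => BA; apply: nB; exists B.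
have SF n : S (iter n F A0) by elim: n => //= n /FP[].
have FS n : {subset iter n F A0 <= iter n.+1 F A0} by have [] := FP _ (SF n).
have Fm m n : (m <= n)%N -> {subset iter m F A0 <= iter n F A0}.
  elim: n => [|n IH]; first by rewrite leqn0 => /eqP ->.
  by rewrite leq_eqVlt => /orP[/eqP -> //|/IH mn x /mn /FS].
pose U : set V := [set x | exists n, x \in iter n F A0].
have UP x : x \in span_mod U <-> U x.
  apply: span_closed; first by exists 0%N; exact: rpred0.
  move=> a y z [n yn] [m zm]; exists (maxn n m).
  rewrite rpredD ?rpredZ//; first exact: (Fm _ _ (leq_maxl n m)).
  exact: (Fm _ _ (leq_maxr n m)).
have [s sP] := fg (span_mod U).
have [n sn] : exists n, [set` s] `<=` [set` iter n F A0].
  have : [set` s] `<=` U by move=> x xs; apply/UP; rewrite sP; exact: mem_span.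
  elim: s {sP} => [|x s IH] sU; first by exists 0%N.
  have [|n sn] := IH; first by move=> y /= ys; apply: sU => /=; rewrite inE ys orbT.
  have [m xm] : U x by apply: sU; rewrite /= mem_head.
  exists (maxn n m) => y /=; rewrite inE => /orP[/eqP ->|ys].
    exact: (Fm _ _ (leq_maxr n m)).
  by apply: (Fm _ _ (leq_maxl n m)); exact: sn.
have [_ _] := FP _ (SF n); apply; apply: submod_ext => x; apply/idP/idP.
  move=> xn; have : x \in span_mod U by apply: mem_span; exists n.+1.
  by rewrite sP => /(span_sub sn).
exact: FS.
Qed.

End Noetherian.

(** * Exponents and boxes *)

Section Exponents.

Definition addx (T : Type) (a b : T -> nat) : T -> nat := fun i => (a i + b i)%N.
Definition subx (T : Type) (a b : T -> nat) : T -> nat := fun i => (a i - b i)%N.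
Definition onex (T : eqType) (y : T) : T -> nat := fun i => (i == y).
Definition cle (T : Type) (a b : T -> nat) := forall i, (a i <= b i)%N.

Lemma addxC (T : Type) (a b : T -> nat) : addx a b = addx b a.
Proof. by apply/funext => i; rewrite /addx addnC. Qed.
Lemma addxA (T : Type) (a b c : T -> nat) : addx a (addx b c) = addx (addx a b) c.
Proof. by apply/funext => i; rewrite /addx addnA. Qed.
Lemma add0x (T : Type) (a : T -> nat) : addx (fun=> 0%N) a = a.
Proof. by apply/funext. Qed.
Lemma subxK (T : Type) (a b : T -> nat) : cle b a -> addx (subx a b) b = a.
Proof. by move=> ba; apply/funext => i; rewrite /addx /subx subnK. Qed.
Lemma addxK (T : Type) (a b : T -> nat) : subx (addx a b) b = a.
Proof. by apply/funext => i; rewrite /addx /subx addnK. Qed.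
Lemma cle_trans (T : Type) (a b c : T -> nat) : cle a b -> cle b c -> cle a c.
Proof. by move=> ab bc i; apply: leq_trans (ab i) (bc i). Qed.
Lemma cle_onex (T : eqType) (y : T) a : (0 < a y)%N -> cle (onex y) a.
Proof. by move=> ay i; rewrite /onex; case: eqP => [->|]. Qed.

Lemma exp_ind (T : finType) (P : (T -> nat) -> Prop) :
  P (fun=> 0%N) -> (forall y a, P a -> P (addx (onex y) a)) -> forall a, P a.
Proof.
move=> P0 PS a; have [n] := ubnP (\sum_i a i); elim: n a => // n IH a an.
have [[y ay]|na] := pselect (exists y, (0 < a y)%N); last first.
  suff -> : a = fun=> 0%N by [].
  by apply/funext => i; apply/eqP; rewrite -leqn0 leqNgt; apply/negP => ai; apply: na; exists i.
rewrite -(subxK (cle_onex ay)) addxC; apply: PS; apply: IH.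
rewrite -ltnS; apply: leq_trans an; rewrite ltnS.
rewrite [X in (_ < X)%N](bigD1 y) //= (bigD1 y) //= /subx /onex eqxx.
rewrite -addSn subn1 prednK // leq_add2l; apply: leq_sum => i /negPf iy.
by rewrite iy subn0.
Qed.

Variable m : nat.
Implicit Types a b c : 'I_m -> nat.

(** Initial exponents refer to the lexicographic order: what counts is that it is
    total, well-founded and compatible with addition. *)
Definition lexlt a b := exists i : 'I_m, (forall j : 'I_m, (j < i)%N -> a j = b j) /\ (a i < b i)%N.

Lemma lexlt_add2l c a b : lexlt a b -> lexlt (addx c a) (addx c b).
Proof.
move=> [i [eqi lti]]; exists i; split=> [j /eqi|]; rewrite /addx ?ltn_add2l //.
by move=> ->.
Qed.

Lemma lexlt_trans b a c : lexlt a b -> lexlt b c -> lexlt a c.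
Proof.
move=> [i [ei li]] [j [ej lj]]; have [ij|ji|ij] := ltngtP i j.
- exists i; split=> [k ki|]; last by rewrite -ej.
  by rewrite ei // ej // (ltn_trans ki).
- exists j; split=> [k kj|]; last by rewrite ei.
  by rewrite ei ?ej // (ltn_trans kj).
- exists i; split=> [k ki|]; first by rewrite ei // ej // -ij.
  by move/val_inj: ij lj => <-; exact: ltn_trans.
Qed.

Lemma lexlt_total a b : a <> b -> lexlt a b \/ lexlt b a.
Proof.
move=> ab; have [i ni] : exists i, a i != b i.
  apply: contrapT => h; apply: ab; apply/funext => i; apply/eqP.
  by apply: contrapT => /negP ?; apply: h; exists i.
case: (@arg_minnP _ i (fun i => a i != b i) (@nat_of_ord m) ni) => j nj jmin.
have ej (k : 'I_m) : (k < j)%N -> a k = b k.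
  by move=> kj; apply/eqP; apply: contraLR kj => /jmin; rewrite -leqNgt.
have [lt|lt|e] := ltngtP (a j) (b j); last by rewrite e eqxx in nj.
  by left; exists j.
by right; exists j; split=> // k /ej.
Qed.

(** Minimize the coordinates one after the other. *)
Lemma lexlt_min (P : ('I_m -> nat) -> Prop) : (exists a, P a) ->
  exists2 a, P a & forall b, P b -> ~ lexlt b a.
Proof.
move=> exP.
suff H k : (k <= m)%N -> exists a, P a /\ forall b, P b -> forall i : 'I_m, (i < k)%N ->
    (forall j : 'I_m, (j < i)%N -> b j = a j) -> (a i <= b i)%N.
  have [a [Pa amin]] := H m (leqnn m).
  by exists a => // b Pb [i [ei li]]; have := amin b Pb i (ltn_ord i) ei; rewrite leqNgt li.
elim: k => [|k IH] km.
  by have [a Pa] := exP; exists a; split.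
have [a [Pa amin]] := IH (ltnW km).
pose ik := Ordinal km.
pose Q n := `[< exists2 b, P b & (forall j : 'I_m, (j < k)%N -> b j = a j) /\ b ik = n >].
have exQ : exists n, Q n by exists (a ik); apply/asboolP; exists a.
case: (ex_minnP exQ) => n /asboolP[b Pb [ba bn]] nmin.
exists b; split=> // d Pd i; rewrite ltnS leq_eqVlt => /orP[/eqP ik_|ik_] di.
  have -> : i = ik by exact: val_inj.
  rewrite bn; apply: nmin; apply/asboolP; exists d => //; split=> // j jk.
  by rewrite di ?ik_ // ba.
rewrite ba //; apply: amin => // j ji; rewrite di // ba //.
exact: ltn_trans ik_.
Qed.

(** A box is a translate of a coordinate face of the orthant. *)
Definition inbox (B : ('I_m -> nat) * {set 'I_m}) a :=
  cle B.1 a /\ forall i, i \notin B.2 -> a i = B.1 i.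

(** What the ascending chain condition gives for a monotone function c, in a form
    that passes to pairs of functions. *)
Definition stationary (X : Type) (c : ('I_m -> nat) -> X) :=
  forall S : set ('I_m -> nat), S !=set0 ->
    exists2 a, S a & forall b, S b -> cle a b -> c b = c a.

Lemma stationary_pair (X Y : Type) (c : ('I_m -> nat) -> X) (d : ('I_m -> nat) -> Y) :
  stationary c -> stationary d -> stationary (fun a => (c a, d a)).
Proof.
move=> sc sd S S0; have [a Sa amax] := sc S S0.
have [|b [Sb ab] bmax] := sd (S `&` [set b | cle a b]); first by exists a; split.
exists b => // e Se be; have ae := cle_trans ab be.
by rewrite (bmax e (conj Se ae) be) !amax.
Qed.

(** Above a point where c is stationary the box needs no subdivision; what
    remains is a finite union of boxes with one free direction less. *)
Lemma box_decomposition (X : Type) (c : ('I_m -> nat) -> X) : stationary c ->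
  exists l : seq (('I_m -> nat) * {set 'I_m}), forall a,
    exists2 B, B \in l & inbox B a /\ forall b, inbox B b -> c b = c B.1.
Proof.
move=> sc.
suff H n (F : {set 'I_m}) b : (#|F| <= n)%N ->
    exists l : seq (('I_m -> nat) * {set 'I_m}), forall a, inbox (b, F) a ->
      exists2 B, B \in l & inbox B a /\ forall b, inbox B b -> c b = c B.1.
  have [l lP] := H _ finset.setT (fun=> 0%N) (leqnn _); exists l => a; apply: lP.
  by split=> // i; rewrite inE.
elim: n F b => [|n IH] F b.
  rewrite leqn0 cards_eq0 => /eqP ->; exists [:: (b, finset.set0)] => a [ba aF].
  exists (b, finset.set0); rewrite ?mem_head //; split; first by split.
  by move=> e [/= be eF]; congr c; apply/funext => i; apply: eF; rewrite inE.
move=> Fn; have [|v [bv vF] vmax] := sc [set a | inbox (b, F) a]; first by exists b; split.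
have /choice[L LP] : forall p : 'I_m * nat, exists l : seq (('I_m -> nat) * {set 'I_m}),
    p.1 \in F -> forall a, inbox ((fun i => if i == p.1 then p.2 else b i), F :\ p.1) a ->
      exists2 B, B \in l & inbox B a /\ forall b, inbox B b -> c b = c B.1.
  move=> [i j] /=; have [iF|_] := boolP (i \in F); last by exists [::].
  have [|l lP] := IH (F :\ i) (fun k => if k == i then j else b k).
    by rewrite (cardsD1 i) iF in Fn.
  by exists l.
exists ((v, F) :: flatten [seq L (i, j) | i <- enum 'I_m, j <- iota 0 (v i)]) => a [ba aF].
have [va|/existsNP[i /negP]] := pselect (cle v a).
  exists (v, F); rewrite ?mem_head //; split.
    by split=> //= i iF; rewrite aF // vF.
  move=> e [/= ve eF]; apply: vmax => //; split; first exact: cle_trans ve.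
  by move=> i iF; rewrite eF // vF.
rewrite -ltnNge => avi.
have iF : i \in F by apply: contraLR avi => iF; rewrite aF // vF // ltnn.
have [|B BL BP] := LP (i, a i) iF a.
  split=> [j|j] /=; first by case: eqP => [->|_] //; exact: ba.
  by rewrite !inE negb_and negbK; case: eqP => [-> //|_ /= /aF].
exists B => //; rewrite inE; apply/orP; right; apply/flattenP; exists (L (i, a i)) => //.
by apply/allpairsPdep; exists i, (a i); rewrite mem_enum mem_iota.
Qed.

End Exponents.

Lemma stationary_mono (R : comPzRingType) (V : lmodType R) m
    (c : ('I_m -> nat) -> submodClosed V) :
  (forall A : submodClosed V, fin_gen A) ->
  (forall a b, cle a b -> {subset c a <= c b}) -> stationary c.
Proof.
move=> fg cm S [a0 Sa0].
have [|_ [a Sa <-] amax] := submod_maximal fg (S := [set c a | a in S]).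
  by exists (c a0); exists a0.
by exists a => // b Sb ab; apply: amax; [exists b|exact: cm].
Qed.

(** * Homogeneous components *)

Section Components.
Variables (I : choiceType) (V : zmodType) (gr : I -> {pred V}).

Definition hcomp (x : V) : I -> V := xget (fun=> 0) [set f | decomposes gr f x].

Definition hclosed (A : {pred V}) := forall x, x \in A -> forall i, hcomp x i \in A.

Hypothesis ds : direct_sum gr.

Lemma hcompP x : decomposes gr (hcomp x) x.
Proof. by have [f [fP _]] := ds.2 x; apply: (@xgetI _ (fun=> 0) [set f | decomposes gr f x] f). Qed.

Lemma hcomp_uniq f x : decomposes gr f x -> hcomp x = f.
Proof.
move=> fP; have [g [_ gu]] := ds.2 x.
by rewrite -(gu _ fP) -(gu _ (hcompP x)).
Qed.

Lemma hcomp_in x i : hcomp x i \in gr i.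
Proof. by case: (hcompP x). Qed.

Lemma hcomp_supp x : exists s : seq I, uniq s /\ forall i, i \notin s -> hcomp x i = 0.
Proof.
have [_ fin _] := hcompP x; have /finite_seqP[s sP] := fin.
exists (undup s); rewrite undup_uniq; split=> // i; rewrite mem_undup => si.
apply/eqP; apply: contraNT si => xi; suff : [set` s] i by [].
by rewrite -sP.
Qed.

Lemma sum_hcomp x (s : seq I) : uniq s -> (forall i, i \notin s -> hcomp x i = 0) ->
  x = \sum_(i <- s) hcomp x i.
Proof.
move=> us s0; have [_ _ {1}->] := hcompP x.
rewrite (fsbigE s) //; last by move=> i _; exact: s0.
by apply: eq_bigl => i; rewrite classical_sets.in_setT.
Qed.

Lemma decomposesI f x (s : seq I) : (forall i, f i \in gr i) -> uniq s ->
  (forall i, i \notin s -> f i = 0) -> x = \sum_(i <- s) f i -> decomposes gr f x.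
Proof.
move=> fg us s0 ->; split=> //.
  apply: (@sub_finite_set _ _ [set` s]); last exact: finite_seq.
  by move=> i /= /eqP fi; apply: contrapT => /negP /s0.
rewrite (fsbigE s) //; last by move=> i _; exact: s0.
by apply: eq_bigl => i; rewrite classical_sets.in_setT.
Qed.

Lemma gr0 i : 0 \in gr i. Proof. by have [] := ds.1 i. Qed.
Lemma grB i : {in gr i &, forall x y, x - y \in gr i}. Proof. by have [] := ds.1 i. Qed.
Lemma grD i : {in gr i &, forall x y, x + y \in gr i}.
Proof.
move=> x y xi yi; rewrite -[y]opprK; apply: grB => //; rewrite -[- y]add0r.
by apply: grB => //; exact: gr0.
Qed.

Lemma hcompD x y i : hcomp (x + y) i = hcomp x i + hcomp y i.
Proof.
have [s [us s0]] := hcomp_supp x; have [t [ut t0]] := hcomp_supp y.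
have {}s0 j : j \notin undup (s ++ t) -> hcomp x j = 0.
  by rewrite mem_undup mem_cat negb_or => /andP[/s0].
have {}t0 j : j \notin undup (s ++ t) -> hcomp y j = 0.
  by rewrite mem_undup mem_cat negb_or => /andP[_ /t0].
have u := undup_uniq (s ++ t).
rewrite (@hcomp_uniq (fun i => hcomp x i + hcomp y i)) //.
apply: (decomposesI _ u) => [j|j js|].
- by apply: grD; exact: hcomp_in.
- by rewrite s0 ?t0 ?addr0.
- by rewrite big_split /= -!sum_hcomp.
Qed.

Lemma hcomp_id x i j : x \in gr i -> hcomp x j = if j == i then x else 0.
Proof.
move=> xi; rewrite (@hcomp_uniq (fun j => if j == i then x else 0)) //.
apply: (@decomposesI _ _ [:: i]) => // [k|k|].
- by case: eqP => [->|_] //; exact: gr0.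
- by rewrite inE => /negPf ->.
- by rewrite big_seq1 eqxx.
Qed.

Lemma hcomp0 i : hcomp 0 i = 0.
Proof. by rewrite (hcomp_id _ (gr0 i)) if_same. Qed.

Lemma hcompB x y i : hcomp (x - y) i = hcomp x i - hcomp y i.
Proof. by apply/eqP; rewrite eq_sym subr_eq -hcompD subrK. Qed.

Lemma hcomp_bigsum (T : Type) (s : seq T) (F : T -> V) i :
  hcomp (\sum_(t <- s) F t) i = \sum_(t <- s) hcomp (F t) i.
Proof. exact: (big_morph (fun x => hcomp x i) (fun x y => hcompD x y i) (hcomp0 i)). Qed.

Lemma homogeneous_hclosed (A : {pred V}) : homogeneous gr A -> hclosed A.
Proof. by move=> hA x /hA[f /hcomp_uniq ->]. Qed.

End Components.

Section GradedModule.
Variables (R : comPzRingType) (grR : nat -> {pred R}) (M : lmodType R).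
Variables (grM : int -> {pred M}).
Hypotheses (rg : ring_grading grR) (mg : module_grading grR grM).
Implicit Types (A B : submodClosed M).
Let dsR : direct_sum grR. Proof. by case: rg. Qed.
Let dsM : direct_sum grM. Proof. by case: mg. Qed.

(** The components of x, multiplied by a and shifted by i, decompose a *: x. *)
Lemma hcomp_scale i (a : R) x j : a \in grR i ->
  hcomp grM (a *: x) j = a *: hcomp grM x (j - i%:Z).
Proof.
move=> ai; have [s [us s0]] := hcomp_supp dsM x.
rewrite (@hcomp_uniq _ _ _ dsM (fun j => a *: hcomp grM x (j - i%:Z))) //.
apply: (@decomposesI _ _ _ _ _ [seq k + i%:Z | k <- s]) => [k||k ks|].
- by have := mg.2 _ _ _ _ ai (hcomp_in dsM x (k - i%:Z)); rewrite [_ + (k - _)]addrC subrK.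
- by rewrite map_inj_uniq //; exact: addIr.
- rewrite s0 ?scaler0 //; apply: contra ks => ks.
  by apply/mapP; exists (k - i%:Z); rewrite ?subrK.
- rewrite big_map {1}(sum_hcomp dsM us s0) scaler_sumr.
  by apply: eq_bigr => k _; rewrite addrK.
Qed.

Lemma sum_hcomp_scale (a : R) (x : M) : exists s : seq nat,
  a *: x = \sum_(i <- s) hcomp grR a i *: x.
Proof.
have [s [us s0]] := hcomp_supp dsR a; exists s.
by rewrite {1}(sum_hcomp dsR us s0) scaler_suml.
Qed.

Lemma hcomp_scale_sum (a : R) x : exists s : seq nat, forall e,
  hcomp grM (a *: x) e = \sum_(i <- s) hcomp grR a i *: hcomp grM x (e - i%:Z).
Proof.
have [s ->] := sum_hcomp_scale a x; exists s => e.
rewrite hcomp_bigsum //; apply: eq_bigr => i _; apply: hcomp_scale; exact: hcomp_in.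
Qed.

Lemma hclosed_span (S : set M) :
  (forall x, S x -> forall e, hcomp grM x e \in span_mod S) -> hclosed grM (span_mod S).
Proof.
move=> hS; apply: span_ind => // [e|a x y hx hy e].
  by rewrite hcomp0 //; exact: rpred0.
rewrite hcompD // rpredD //; have [s ->] := hcomp_scale_sum a x.
by apply: submod_sum => i _; exact: rpredZ.
Qed.

(** A homogeneous element is annihilated modulo a graded submodule by the
    components of whatever annihilates it. *)
Lemma hcomp_ann B (a : R) x d i : hclosed grM B -> x \in grM d -> a *: x \in B ->
  hcomp grR a i *: x \in B.
Proof.
move=> hB xd aB; have [s [us s0]] := hcomp_supp dsR a.
have [is_|/s0 ->] := boolP (i \in s); last by rewrite scale0r; exact: rpred0.
suff <- : hcomp grM (a *: x) (i%:Z + d) = hcomp grR a i *: x by exact: hB.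
rewrite {1}(sum_hcomp dsR us s0) scaler_suml hcomp_bigsum // (bigD1_seq i) //= big1.
  by rewrite addr0 (hcomp_id dsM _ (mg.2 _ _ _ _ (hcomp_in dsR a i) xd)) eqxx.
move=> j ji; rewrite (hcomp_id dsM _ (mg.2 _ _ _ _ (hcomp_in dsR a j) xd)).
by rewrite (inj_eq (addIr _)) eqz_nat eq_sym (negPf ji).
Qed.

(** R has no negative degrees, so scaling cannot go below the least degree of
    the components of the generators. *)
Lemma degree_bounded_below : fin_gen (full_mod M) ->
  exists d0 : int, forall x e, x \in grM e -> x != 0 -> d0 <= e.
Proof.
move=> [s sP].
have [d0 dP] : exists d0 : int, forall x, x \in s -> forall e, e < d0 -> hcomp grM x e = 0.
  elim: s {sP} => [|x s [d dP]]; first by exists 0.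
  have [t [_ t0]] := hcomp_supp dsM x.
  have [d1 d1P] : exists d1 : int, forall e, e \in t -> d1 <= e.
    elim: t {t0} => [|e t [d1 d1P]]; first by exists 0.
    exists (Num.min e d1) => f; rewrite inE ge_min => /orP[/eqP ->|/d1P ->].
      by rewrite lexx.
    by rewrite orbT.
  exists (Num.min d d1) => y; rewrite inE => /orP[/eqP ->|ys] e; rewrite lt_min => /andP[ed ed1].
    by apply: t0; apply/negP => /d1P; rewrite leNgt ed1.
  exact: dP.
exists d0 => x e xe; apply: contraNT; rewrite -ltNge => ed0.
have xs : x \in span_mod [set` s] by rewrite -sP.
suff : hcomp grM x e = 0 by rewrite (hcomp_id dsM _ xe) eqxx => ->.
move: x xs {xe} e ed0; apply: span_ind => [e _|a x y hx hy e ed|x xs e].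
- by rewrite hcomp0.
- rewrite hcompD // hy // addr0; have [t ->] := hcomp_scale_sum a x.
  rewrite big1 // => i _; rewrite hx ?scaler0 //.
  by apply: le_lt_trans ed; rewrite gerBl.
- exact: dP.
Qed.

End GradedModule.

Lemma homogeneous_generators (R : comPzRingType) (grR : nat -> {pred R})
    (I : submodClosed R^o) : noetherian R -> ring_grading grR -> homogeneous grR I ->
  exists s : seq (R * nat), (forall p, p \in s -> p.1 \in grR p.2) /\
    I =i span_mod [set a : R^o | exists2 p, p \in s & a = p.1].
Proof.
move=> nR [ds _ _] /(homogeneous_hclosed ds) hI; have [t tP] := nR I.
have tI x : x \in t -> x \in I by move=> xt; rewrite tP; exact: mem_span.
suff [s [sg sI ts]] : exists s : seq (R * nat), [/\ forall p, p \in s -> p.1 \in grR p.2,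
    forall p, p \in s -> p.1 \in I
    & forall x : R^o, x \in t -> x \in span_mod [set a : R^o | exists2 p, p \in s & a = p.1]].
  exists s; split=> // x; apply/idP/idP.
    by rewrite tP; apply: span_sub => y; exact: ts.
  by apply: span_sub => _ [p /sI + ->].
elim: t {tP} tI => [|x t IH] tI; first by exists [::].
have [|s [sg sI ts]] := IH; first by move=> y yt; apply: tI; rewrite inE yt orbT.
have [u [uu u0]] := hcomp_supp ds x.
exists ([seq (hcomp grR x i, i) | i <- u] ++ s); split=> [p|p|y].
- by rewrite mem_cat => /orP[/mapP[i _ ->]|/sg //]; exact: hcomp_in.
- rewrite mem_cat => /orP[/mapP[i _ ->]|/sI //]; apply: hI; apply: tI; exact: mem_head.
- rewrite inE => /orP[/eqP ->|/ts]; last first.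
    by apply: span_mono => _ [p ps ->]; exists p => //; rewrite mem_cat ps orbT.
  rewrite {1}(sum_hcomp ds uu u0) big_seq.
  apply: (@submod_sum R R^o) => i iu; apply: mem_span; exists (hcomp grR x i, i) => //.
  by rewrite mem_cat; apply/orP; left; apply/mapP; exists i.
Qed.

(** * Powers of ideals and initial coefficients *)

Section Powers.
Variables (R : comPzRingType) (r : nat) (I : 'I_r -> submodClosed R^o).

Lemma ideal_expD (J : submodClosed R^o) i j :
  ideal_exp J (i + j) = ideal_mul (ideal_exp J i) (ideal_exp J j).
Proof.
elim: i => [|i IH]; first by rewrite add0n ideal_mul_full.
by rewrite addSn /ideal_exp !iterS -!/(ideal_exp _ _) IH ideal_mulA.
Qed.

Lemma mexpD n n' :
  ideal_mexp I (addx n n') = ideal_mul (ideal_mexp I n) (ideal_mexp I n').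
Proof. by rewrite /ideal_mexp -big_split; apply: eq_bigr => i _; exact: ideal_expD. Qed.

Lemma mexp0 : ideal_mexp I (fun=> 0%N) = full_mod R^o.
Proof. by rewrite /ideal_mexp big1. Qed.

Lemma mexp1 k : ideal_mexp I (onex k) = I k.
Proof.
rewrite /ideal_mexp (bigD1 k) //= big1 => [|i /negPf ik]; rewrite /onex ?ik //.
by rewrite eqxx /ideal_exp /= ideal_mulC ideal_mul_full ideal_mulC ideal_mul_full.
Qed.

Variable M : lmodType R.
Implicit Types (Q : submodClosed M).

Definition pw n Q := ideal_mul (ideal_mexp I n) Q.

Lemma pw0 Q : pw (fun=> 0%N) Q = Q.
Proof. by rewrite /pw mexp0 ideal_mul_full. Qed.
Lemma pwD n n' Q : pw (addx n n') Q = pw n (pw n' Q).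
Proof. by rewrite /pw mexpD ideal_mulA. Qed.
Lemma pw1 k Q : pw (onex k) Q = ideal_mul (I k) Q.
Proof. by rewrite /pw mexp1. Qed.
Lemma pw_mono n Q Q' : {subset Q <= Q'} -> {subset pw n Q <= pw n Q'}.
Proof. by move=> QQ'; apply: ideal_mulS. Qed.
Lemma pw_sub n Q : {subset pw n Q <= Q}.
Proof. exact: ideal_mul_subr. Qed.
Lemma pw_anti n n' Q : cle n n' -> {subset pw n' Q <= pw n Q}.
Proof. by move=> nn'; rewrite -(subxK nn') pwD; exact: pw_sub. Qed.

End Powers.

Section Monomials.
Variables (R : comPzRingType) (r : nat) (I : 'I_r -> submodClosed R^o).
Variables (m : nat) (kp : 'I_m -> 'I_r) (g : 'I_m -> R).
Hypothesis Igen : forall k, I k =i span_mod [set x : R^o | exists2 y, kp y = k & x = g y].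
Variable M : lmodType R.
Implicit Types (Q : submodClosed M) (a b : 'I_m -> nat) (n : 'I_r -> nat).
Local Notation pw := (pw I).

Definition mon a : R := \prod_y g y ^+ a y.
Definition mdeg a : 'I_r -> nat := fun k => (\sum_(y | kp y == k) a y)%N.

Lemma monD a b : mon (addx a b) = mon a * mon b.
Proof. by rewrite /mon -big_split; apply: eq_bigr => y _; rewrite exprD. Qed.
Lemma mon0 : mon (fun=> 0%N) = 1. Proof. by rewrite /mon big1. Qed.
Lemma mon1 y : mon (onex y) = g y.
Proof.
rewrite /mon (bigD1 y) //= big1 => [|i /negPf iy]; rewrite /onex ?iy //.
by rewrite eqxx mulr1.
Qed.

Lemma mdegD a b : mdeg (addx a b) = addx (mdeg a) (mdeg b).
Proof. by apply/funext => k; rewrite /mdeg /addx big_split. Qed.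
Lemma mdeg0 : mdeg (fun=> 0%N) = fun=> 0%N.
Proof. by apply/funext => k; rewrite /mdeg big1. Qed.
Lemma mdeg1 y : mdeg (onex y) = onex (kp y).
Proof.
apply/funext => k; rewrite /mdeg {2}/onex eq_sym; case: eqP => [<-|yk].
  by rewrite (bigD1 y) //= big1 => [|i /andP[_ /negPf iy]]; rewrite /onex ?iy ?eqxx.
by rewrite big1 // => i /eqP ik; rewrite /onex; case: eqP => // iy; rewrite iy in ik.
Qed.

Lemma gen_in y : g y \in I (kp y).
Proof. by rewrite Igen; apply: mem_span; exists y. Qed.

Lemma mon_pw a Q x : x \in Q -> mon a *: x \in pw (mdeg a) Q.
Proof.
move: a; apply: exp_ind => [|y a IH] Qx; first by rewrite mon0 mdeg0 pw0 scale1r.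
rewrite monD mon1 -scalerA mdegD mdeg1 pwD pw1.
by apply: mem_ideal_mul; [exact: gen_in|exact: IH].
Qed.

(** Restricting S filters the powers [pw n Q] by initial exponents. *)
Definition mspan (S : set ('I_m -> nat)) Q : submodClosed M :=
  span_mod [set x | exists b q, [/\ S b, q \in Q & x = mon b *: q]].

Lemma mspan_mono S S' Q : S `<=` S' -> {subset mspan S Q <= mspan S' Q}.
Proof. by move=> SS'; apply: span_mono => _ [b [q [/SS' ? ? ->]]]; exists b, q. Qed.

Lemma mem_mspan (S : set ('I_m -> nat)) Q b q : S b -> q \in Q -> mon b *: q \in mspan S Q.
Proof. by move=> Sb Qq; apply: mem_span; exists b, q. Qed.

Lemma scale_mspan S S' Q y x : (forall b, S b -> S' (addx (onex y) b)) ->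
  x \in mspan S Q -> g y *: x \in mspan S' Q.
Proof.
move=> SS'; move: x; apply: span_ind.
- by rewrite scaler0; exact: rpred0.
- by move=> c u v ? ?; rewrite scalerDr scalerA mulrC -scalerA rpredD // rpredZ.
- by move=> _ [b [q [Sb Qq ->]]]; rewrite scalerA -mon1 -monD mem_mspan //; exact: SS'.
Qed.

Lemma pwE n Q : pw n Q = mspan [set b | mdeg b = n] Q.
Proof.
apply: submod_ext => x; apply/idP/idP; last first.
  by apply: span_sub => _ [b [q [<- Qq ->]]]; exact: mon_pw.
move: n x; apply: exp_ind => [|k n IH] x.
  rewrite pw0 => Qx; rewrite -[x]scale1r -mon0; apply: mem_mspan => //; exact: mdeg0.
rewrite pwD pw1; apply: ideal_mul_sub => c {}x + /IH; rewrite Igen.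
move=> + xS; move: c; apply: (@span_ind R R^o).
- by rewrite scale0r; exact: rpred0.
- by move=> c u v ? ?; rewrite scalerDl -scalerA rpredD // rpredZ.
- move=> _ [y <- ->]; apply: scale_mspan xS => b <-.
  by rewrite /= mdegD mdeg1.
Qed.

(** Of two elements the one with the larger initial exponent determines the initial
    term of a linear combination; when the exponents agree the coefficients
    combine. *)
Lemma leading_term S Q x : x \in mspan S Q -> x = 0 \/
  exists a q, [/\ S a, q \in Q & x - mon a *: q \in mspan (S `&` [set b | lexlt b a]) Q].
Proof.
move: x; apply: span_ind; first by left.
- move=> c x y hx [-> |[b [q' [Sb Qq' yb]]]].
    case: hx => [-> |[a [q [Sa Qq xa]]]]; first by left; rewrite scaler0 addr0.
    right; exists a, (c *: q); split; rewrite ?rpredZ //.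
    by rewrite addr0 scalerA mulrC -scalerA -scalerBr rpredZ.
  right; case: hx => [-> |[a [q [Sa Qq xa]]]].
    by exists b, q'; split=> //; rewrite scaler0 add0r.
  have lo a' : lexlt a a' -> {subset mspan (S `&` [set b | lexlt b a]) Q <=
      mspan (S `&` [set b | lexlt b a']) Q}.
    by move=> aa'; apply: mspan_mono => e [Se ea]; split=> //; exact: lexlt_trans aa'.
  have lo' a' : lexlt b a' -> {subset mspan (S `&` [set e | lexlt e b]) Q <=
      mspan (S `&` [set b | lexlt b a']) Q}.
    by move=> aa'; apply: mspan_mono => e [Se ea]; split=> //; exact: lexlt_trans aa'.
  have [ab|/lexlt_total[ab|ba]] := pselect (a = b).
  + exists a, (c *: q + q'); split; [by []|by rewrite rpredD ?rpredZ|rewrite scalerDr].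
    by rewrite opprD addrACA scalerA mulrC -scalerA -scalerBr rpredD ?rpredZ // ab.
  + exists b, q'; split=> //; rewrite -addrA rpredD //.
    rewrite rpredZ // -[x](subrK (mon a *: q)) rpredD //; first exact: lo xa.
    exact: mem_mspan.
  + exists a, (c *: q); split; rewrite ?rpredZ //.
    rewrite addrAC scalerA mulrC -scalerA -scalerBr rpredD //; first by rewrite rpredZ.
    rewrite -[y](subrK (mon b *: q')) rpredD //; first exact: lo' yb.
    exact: mem_mspan.
- move=> _ [b [q [Sb Qq ->]]]; right; exists b, q; split=> //.
  by rewrite subrr; exact: rpred0.
Qed.

Definition lower Q a := mspan ([set b | mdeg b = mdeg a] `&` [set b | lexlt b a]) Q.

(** Descent along the filtration by initial exponents: among the nonzero
    elements with property P choose one with minimal initial exponent. *)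
Lemma minimal_leading_term Q n (P : M -> Prop) :
  (exists2 x, x \in pw n Q & P x) -> ~ P 0 ->
  exists a x q, [/\ mdeg a = n, P x, q \in Q, x - mon a *: q \in lower Q a &
    forall x', P x' -> x' \notin lower Q a].
Proof.
rewrite pwE => -[x xn Px] P0.
have [|a [ma [z [q [Pz Qq za]]]] amin] := @lexlt_min m (fun a => mdeg a = n /\
    exists x q, [/\ P x, q \in Q & x - mon a *: q \in lower Q a]).
  have [x0|[a [q [<- Qq xa]]]] := leading_term xn; first by rewrite x0 in Px.
  by exists a; split=> //; exists x, q.
exists a, z, q; split=> // x' Px'; apply/negP => /leading_term[x0|].
  by rewrite x0 in Px'.
move=> [b [q' [[mb ba] Qq' xb]]]; apply: (amin b) => //; rewrite -ma; split=> //.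
exists x', q'; split=> //; apply: mspan_mono xb => e [[/= me ea] eb]; split=> //=.
by rewrite me mb.
Qed.

Lemma scale_lower Q y a x : x \in lower Q a -> g y *: x \in lower Q (addx (onex y) a).
Proof.
apply: scale_mspan => b [/= mb ba]; split=> /=; first by rewrite !mdegD mb.
exact: lexlt_add2l.
Qed.

(** The initial coefficients at the exponent a: the element z of the family is
    mon a *: x up to lower terms. *)
Definition lead Q (Z : ('I_r -> nat) -> submodClosed M) a : submodClosed M :=
  span_mod [set x | exists2 z, z \in Z (mdeg a) & mon a *: x - z \in lower Q a].

Lemma leadP Q Z a x : x \in lead Q Z a <->
  exists2 z, z \in Z (mdeg a) & mon a *: x - z \in lower Q a.
Proof.
apply: span_closed; first by exists 0; rewrite ?scaler0 ?subr0; exact: rpred0.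
move=> c {}x y [z Zz hx] [w Zw hy]; exists (c *: z + w); first by rewrite rpredD // rpredZ.
by rewrite scalerDr opprD addrACA scalerA mulrC -scalerA -scalerBr rpredD // rpredZ.
Qed.

(** The families that are modules over the multi-Rees ring. *)
Definition rees (Z : ('I_r -> nat) -> submodClosed M) :=
  forall k n, {subset ideal_mul (I k) (Z n) <= Z (addx (onex k) n)}.

(** Multiplying by a generator of I_k moves initial exponents but keeps the
    coefficients. *)
Lemma lead_mono Q Z a b : rees Z -> cle a b -> {subset lead Q Z a <= lead Q Z b}.
Proof.
move=> rZ ab; rewrite -(subxK ab); move: (subx b a) => e.
move: e; apply: exp_ind => [|y e IH] x xa; first by rewrite add0x.
have /leadP[z Zz hz] := IH _ xa; apply/leadP; exists (g y *: z).
  rewrite -addxA mdegD mdeg1; apply: rZ; apply: mem_ideal_mul Zz; exact: gen_in.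
by rewrite -addxA monD mon1 -scalerA -scalerBr; exact: scale_lower.
Qed.

Hypothesis fgM : forall A : submodClosed M, fin_gen A.

Lemma stationary_lead Q Z : rees Z -> stationary (lead Q Z).
Proof. by move=> rZ; apply: (stationary_mono fgM) => a b; exact: lead_mono. Qed.

Lemma mdeg_onex_le a b k : cle b a -> (mdeg b k < mdeg a k)%N ->
  exists2 y, kp y = k & (b y < a y)%N.
Proof.
move=> ba lt; apply: contrapT => h; move: lt; rewrite ltnNge => /negP; apply.
apply: leq_sum => y /eqP yk; rewrite leqNgt; apply/negP => lt; apply: h.
by exists y.
Qed.

(** Every initial coefficient at a already occurs at the corner of the box of a.
    When the k-th degree of a exceeds that of the corner, some generator of I_k
    divides the initial monomial with the coefficient still available for the
    quotient, and the initial term can be cancelled by an element of I_k Z_n. *)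
Lemma rees_fin_gen Q Z : rees Z -> (forall n, {subset Z n <= pw n Q}) ->
  exists N : nat, forall k n, (N <= n k)%N ->
    {subset Z (addx (onex k) n) <= ideal_mul (I k) (Z n)}.
Proof.
move=> rZ ZQ; have [l lP] := box_decomposition (stationary_lead Q rZ).
(* Beyond this bound an exponent has left the corner of its box in direction k. *)
exists (\max_(B <- l) \max_(k < r) mdeg B.1 k) => k n Nn x xZ.
apply: contrapT => /negP xnot.
have [||a [z [q [ma [Zz zn] Qq zq amin]]]] := @minimal_leading_term Q (addx (onex k) n)
    (fun x => x \in Z (addx (onex k) n) /\ x \notin ideal_mul (I k) (Z n)).
- by exists x => //; exact: ZQ.
- by case=> _; rewrite rpred0.
have [[b F] Bl [aB Bc]] := lP a; have ba : cle b a by case: aB.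
have [|y yk by_] := @mdeg_onex_le a b k ba.
  apply: (@leq_ltn_trans (n k)); last by rewrite ma /addx /onex eqxx.
  apply: leq_trans Nn; apply: leq_trans (leq_bigmax_seq _ Bl isT) => /=.
  exact: (@leq_bigmax _ (mdeg b)).
pose a' := subx a (onex y).
have aE : a = addx (onex y) a'.
  by rewrite addxC subxK //; apply: cle_onex; apply: leq_ltn_trans by_.
have ma' : mdeg a' = n.
  rewrite aE mdegD mdeg1 yk in ma; apply/funext => i.
  by have /(congr1 (@^~ i)) := ma; rewrite /addx => /addnI.
have qa : q \in lead Q Z a.
  by apply/leadP; exists z; rewrite ?ma // -opprB rpredN.
have ba' : cle b a'.
  move=> i; rewrite /a' /subx /onex; case: eqP => [->|_]; last by rewrite subn0.
  by rewrite subn1 -ltnS prednK //; apply: leq_ltn_trans by_.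
have qa' : q \in lead Q Z a'.
  apply: (lead_mono rZ ba'); by rewrite -[lead Q Z b](Bc a).
have /leadP[w Zw hw] := qa'.
pose t := g y *: w.
have tI : t \in ideal_mul (I k) (Z n).
  by apply: mem_ideal_mul; [rewrite -yk; exact: gen_in|rewrite -ma'].
have /amin/negP : z - t \in Z (addx (onex k) n) /\ z - t \notin ideal_mul (I k) (Z n).
  split; first by rewrite submodB //; exact: rZ.
  by apply: contra zn => h; rewrite -[z](subrK t) rpredD.
apply; have -> : z - t = (z - mon a *: q) + (mon a *: q - t) by rewrite addrA subrK.
rewrite rpredD // /t aE monD mon1 -scalerA -scalerBr; exact: scale_lower.
Qed.

End Monomials.

(** * Associated primes *)

Section AssociatedPrimes.
Variables (R : comPzRingType) (M : lmodType R).
Implicit Types (B : submodClosed M) (p : submodClosed R^o).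

Definition colon_is B x p := forall c : R, (c \in p) = (c *: x \in B).

Lemma colon_exists B x : exists p, colon_is B x p.
Proof.
pose p : submodClosed R^o := span_mod [set c : R^o | (c : R) *: x \in B].
exists p => c.
apply/idP/idP; last by move=> cB; exact: mem_span.
move=> /(@span_closed R R^o); apply.
  rewrite /= (_ : ((0 : R^o) : R) *: x = 0); last exact: scale0r.
  exact: rpred0.
move=> a u v uB vB /=; have -> : ((a *: u + v : R^o) : R) *: x = a *: ((u : R) *: x) + (v : R) *: x.
  by rewrite scalerDl -scalerA.
by rewrite rpredD // rpredZ.
Qed.

Definition Ass_mod B : set (submodClosed R^o) :=
  [set p | prime_ideal p /\ exists x, colon_is B x p].

Lemma colon_scale B x p (b : R) : prime_ideal p -> colon_is B x p -> b \notin p ->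
  colon_is B (b *: x) p.
Proof.
move=> [_ pp] xp bp c; rewrite scalerA -xp.
apply/idP/idP => [cp|/pp[//|]]; last by rewrite (negPf bp).
by rewrite mulrC; apply: (rpredZ b cp).
Qed.

Lemma prime_expr p (a : R) n : prime_ideal p -> a \notin p -> a ^+ n \notin p.
Proof.
move=> [p1 pp] ap; elim: n => [//|n IH]; rewrite exprS.
by apply/negP => /pp[]; apply/negP.
Qed.

(** A maximal annihilator of a nonzero element is prime. *)
Lemma Ass_mod_nonempty B x : noetherian R -> x \notin B -> Ass_mod B !=set0.
Proof.
move=> nR xB.
have [|p [y yB yp] pmax] := submod_maximal nR
    (S := [set p | exists2 y, y \notin B & colon_is B y p]).
  by have [p pP] := colon_exists B x; exists p; exists x.
exists p; split; last by exists y.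
split=> [|a b]; first by rewrite yp scale1r.
have [ay|ay] := boolP (a *: y \in B); first by rewrite -yp in ay; left.
have [q qP] := colon_exists B (a *: y).
rewrite [a * b]mulrC (yp (b * a)) -scalerA -(qP b) => bq; right.
suff <- : q = p by [].
apply: pmax; first by exists (a *: y).
move=> c; rewrite yp qP => cy.
have -> : (c : R) *: (a *: y) = a *: ((c : R) *: y) by rewrite !scalerA mulrC.
by rewrite rpredZ.
Qed.

(** Noetherian induction: enlarging B by an element with prime annihilator q
    modulo B loses no associated prime except possibly q. *)
Lemma finite_Ass_mod B : noetherian R -> (forall A : submodClosed M, fin_gen A) ->
  finite_set (Ass_mod B).
Proof.
move=> nR fgM; apply: contrapT => nfin.
have [|{nfin}{}B nfin Bmax] := submod_maximal fgM (S := [set B | ~ finite_set (Ass_mod B)]).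
  by exists B.
have [x xB] : exists x, x \notin B.
  apply: contrapT => h; apply: nfin; rewrite (_ : Ass_mod B = set0) //.
  rewrite -subset0 => p [[p1 _] [x xp]]; move/negP: p1; apply; rewrite xp.
  by apply: contrapT => /negP xB; apply: h; exists (1 *: x).
have [q [qpr [y yq]]] := Ass_mod_nonempty nR xB.
have yB : y \notin B by have [q1 _] := qpr; rewrite yq scale1r in q1.
pose B' : submodClosed M := span_mod [set z | exists2 c : R, True & z - c *: y \in B].
have B'P z : z \in B' <-> exists2 c : R, True & z - c *: y \in B.
  apply: span_closed; first by exists 0; rewrite // scale0r subr0; exact: rpred0.
  move=> a u v [c _ uB] [d _ vB]; exists (a * c + d) => //.
  by rewrite scalerDl -scalerA opprD addrACA -scalerBr rpredD // rpredZ.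
have BB' : {subset B <= B'}.
  by move=> z zB; apply/B'P; exists 0; rewrite // scale0r subr0.
have fin' : finite_set (Ass_mod B').
  apply: contrapT => nf; have /esym E := Bmax B' nf BB'; move/negP: yB; apply; rewrite E.
  by apply/B'P; exists 1; rewrite // scale1r subrr; exact: rpred0.
apply: nfin; apply: (@sub_finite_set _ _ (q |` Ass_mod B')); last first.
  by rewrite finite_setU; split=> //; exact: finite_set1.
move=> p [ppr [z zp]].
have [[b bz bB']|h] := pselect (exists2 b : R, b *: z \notin B & b *: z \in B').
  have [c _ hc] := (B'P _).1 bB'; left; apply: submod_ext => a.
  have bp : b \notin p by rewrite zp.
  have cq : c \notin q.
    rewrite yq; apply: contra bz => cy.
    by rewrite -[b *: z](subrK (c *: y)) rpredD.
  rewrite (colon_scale ppr zp bp) (colon_scale qpr yq cq).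
  apply/idP/idP => h.
    have -> : a *: (c *: y) = a *: (b *: z) - a *: (b *: z - c *: y).
      by rewrite scalerBr opprB addrC subrK.
    by rewrite submodB // rpredZ.
  rewrite -[b *: z](subrK (c *: y)) scalerDr rpredD // rpredZ //.
right; split=> //; exists z => c; rewrite zp; apply/idP/idP; first exact: BB'.
by move=> cB'; apply: contrapT => /negP cB; apply: h; exists c.
Qed.

End AssociatedPrimes.

(** * Eventual minima of linear functions *)

Section MinLinear.
Variable r : nat.
Implicit Types (E : ('I_r -> nat) -> int -> Prop) (n : 'I_r -> nat).

Definition lin (t : ('I_r -> nat) * int) n : int := (\sum_(i < r) t.1 i * n i)%N%:Z + t.2.

(** The minimum of the degrees d with [E n d] is eventually the minimum of a
    finite, possibly empty, list of linear functions; phrased so that no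
    minimum has to exist beforehand. *)
Definition min_linear E :=
  exists (l : seq (('I_r -> nat) * int)) (N : 'I_r -> nat), forall n, cle N n ->
  (forall d, E n d -> exists2 t, t \in l & lin t n <= d) /\
  (forall t, t \in l -> E n (lin t n)).

Lemma min_linear0 E N : (forall n d, cle N n -> ~ E n d) -> min_linear E.
Proof. by move=> E0; exists [::], N => n Nn; split=> // d /(E0 n d Nn). Qed.

Lemma min_linearU E E' : min_linear E -> min_linear E' ->
  min_linear (fun n d => E n d \/ E' n d).
Proof.
move=> [l [N h]] [l' [N' h']]; exists (l ++ l'), (addx N N') => n Nn.
have [|lo hi] := h n; first by move=> i; apply: leq_trans (Nn i); exact: leq_addr.
have [|lo' hi'] := h' n; first by move=> i; apply: leq_trans (Nn i); exact: leq_addl.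
split=> [d [/lo|/lo'] [t tl td]|t].
- by exists t; rewrite // mem_cat tl.
- by exists t; rewrite // mem_cat tl orbT.
- by rewrite mem_cat => /orP[/hi|/hi']; [left|right].
Qed.

Lemma min_linear_eq E E' N : (forall n d, cle N n -> E n d <-> E' n d) ->
  min_linear E' -> min_linear E.
Proof.
move=> EE' [l [N' h]]; exists l, (addx N N') => n Nn.
have Nn1 : cle N n by move=> i; apply: leq_trans (Nn i); exact: leq_addr.
have [|lo hi] := h n; first by move=> i; apply: leq_trans (Nn i); exact: leq_addl.
by split=> [d /EE' -/(_ Nn1) /lo //|t /hi]; move/EE' => /(_ Nn1).
Qed.

Lemma min_linear_seq (T : eqType) (s : seq T) (E : T -> ('I_r -> nat) -> int -> Prop) :
  (forall p, p \in s -> min_linear (E p)) ->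
  min_linear (fun n d => exists2 p, p \in s & E p n d).
Proof.
elim: s => [|p s IH] hE.
  by apply: (@min_linear0 _ (fun=> 0%N)) => n d _ [].
apply: (@min_linear_eq _ (fun n d => E p n d \/ exists2 p, p \in s & E p n d) (fun=> 0%N)).
  move=> n d _; split=> [[q]|[pE|[q qs qE]]].
  - by rewrite inE => /orP[/eqP -> ?|? ?]; [left|right; exists q].
  - by exists p => //; exact: mem_head.
  - by exists q; rewrite // inE qs orbT.
apply: min_linearU; first by apply: hE; exact: mem_head.
by apply: IH => q qs; apply: hE; rewrite inE qs orbT.
Qed.

Lemma min_linear_finite (T : Type) (S : set T) (E : T -> ('I_r -> nat) -> int -> Prop) :
  finite_set S -> (forall p, S p -> min_linear (E p)) ->
  min_linear (fun n d => exists2 p, S p & E p n d).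
Proof.
move=> /(@finite_seqP {classic T})[s ->] hE.
exact: (@min_linear_seq {classic T}).
Qed.

Lemma min_linear_shift E k : min_linear E ->
  min_linear (fun n d => (0 < n k)%N /\ E (subx n (onex k)) d).
Proof.
move=> [l [N h]].
exists [seq (t.1, t.2 - (t.1 k)%:Z) | t <- l], (addx N (onex k)) => n Nn.
have nk : (0 < n k)%N.
  by apply: leq_trans (Nn k); rewrite /addx /onex eqxx addn1.
have linE t : lin (t.1, t.2 - (t.1 k)%:Z) n = lin t (subx n (onex k)).
  rewrite /lin /= -{1}(subxK (cle_onex nk)).
  under eq_bigr do rewrite mulnDr.
  rewrite big_split /= [X in (_ + X)%N](bigD1 k) //= [X in (_ + (_ + X))%N]big1; last first.
    by move=> i /negPf ik; rewrite /onex ik muln0.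
  by rewrite /onex eqxx muln1 addn0 PoszD; lia.
have [|lo hi] := h (subx n (onex k)).
  by move=> i; rewrite /subx leq_subRL ?[(onex k i + _)%N]addnC; [exact: Nn|exact: cle_onex].
split=> [d [_ /lo[t tl td]]|_ /mapP[t /hi tE ->]].
  exists (t.1, t.2 - (t.1 k)%:Z); last by rewrite linE.
  by apply/mapP; exists t.
by rewrite linE.
Qed.

End MinLinear.

Lemma int_minimum (D : set int) d0 : D !=set0 -> (forall e, D e -> d0 <= e) ->
  exists2 e, D e & forall f, D f -> e <= f.
Proof.
move=> [e De] D0; pose P n := `[< D (d0 + n%:Z) >].
have DP f : D f -> P `|f - d0|%N.
  by move=> Df; apply/asboolP; rewrite gez0_abs ?subr_ge0 ?D0 // [d0 + _]addrC subrK.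
case: (ex_minnP (ex_intro P _ (DP e De))) => n /asboolP Dn nmin.
exists (d0 + n%:Z) => // f Df; have := nmin _ (DP f Df).
by rewrite -lerBrDl -lez_nat gez0_abs // subr_ge0 D0.
Qed.

Section Boxes.
Variables (r m : nat) (kp : 'I_m -> 'I_r) (dl : 'I_m -> nat).
Local Notation mdeg := (mdeg kp).

Definition weight (a : 'I_m -> nat) : nat := (\sum_y a y * dl y)%N.

Lemma weightD a b : weight (addx a b) = (weight a + weight b)%N.
Proof. by rewrite /weight -big_split; apply: eq_bigr => y _; rewrite mulnDl. Qed.

(** On a box the cheapest way to raise the multidegree in the direction k is to
    multiply by the cheapest free generator of the k-th ideal, if there is one. *)
Lemma min_linear_box (B : ('I_m -> nat) * {set 'I_m}) (D : set int) d0 :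
  (forall e, D e -> d0 <= e) ->
  min_linear (fun n d => exists a, [/\ inbox B a, mdeg a = n & D (d - (weight a)%:Z)]).
Proof.
case: B => b F D0.
have [DN|/set0P Dn0] := eqVneq D set0.
  by apply: (@min_linear0 _ _ (fun=> 0%N)) => n d _ [a [_ _]]; rewrite DN.
have [e0 De0 e0min] := int_minimum Dn0 D0.
have [[k kF]|hF] := pselect (exists k, forall y, y \in F -> kp y != k).
  apply: (@min_linear0 _ _ (addx (mdeg b) (onex k))) => n d /(_ k) + [a [[_ aF] ma _]].
  rewrite /addx /onex eqxx addn1 -ma; apply/negP; rewrite -leqNgt.
  apply: leq_sum => y /eqP yk; rewrite aF //; apply/negP => /kF.
  by rewrite yk eqxx.
have /choice[ys ysP] : forall k, exists y, [/\ y \in F, kp y = k &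
    forall z, z \in F -> kp z = k -> (dl y <= dl z)%N].
  move=> k; have [y /andP[yF /eqP yk]] : exists y, (y \in F) && (kp y == k).
    apply: contrapT => h; apply: hF; exists k => y yF; apply/negP => yk.
    by apply: h; exists y; rewrite yF.
  case: (@arg_minnP _ y (fun y => (y \in F) && (kp y == k)) dl); rewrite ?yF ?yk ?eqxx //.
  move=> z /andP[zF /eqP zk] zmin; exists z; split=> // x xF xk; apply: zmin.
  by rewrite xF xk eqxx.
pose w k := dl (ys k).
pose W (n : 'I_r -> nat) := (\sum_k w k * n k)%N.
have WD n n' : W (addx n n') = (W n + W n')%N.
  by rewrite /W -big_split; apply: eq_bigr => k _; rewrite mulnDr.
have linE n d : lin (w, d) n = (W n)%:Z + d by [].
exists [:: (w, (weight b)%:Z - (W (mdeg b))%:Z + e0)], (mdeg b) => n bn; split.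
  move=> d [a [[/= ba aF] <- /e0min]] ed; eexists; first exact: mem_head.
  rewrite linE -(subxK ba) mdegD WD; rewrite -(subxK ba) weightD in ed.
  have le : (W (mdeg (subx a b)) <= weight (subx a b))%N.
    rewrite /W /mdeg /weight (partition_big kp predT) //=; apply: leq_sum => k _.
    rewrite big_distrr /=; apply: leq_sum => y /eqP yk; rewrite mulnC leq_mul2l.
    have [yF|yF] := boolP (y \in F); last by rewrite /subx aF // subnn.
    by have [_ _ ->] := ysP k; rewrite ?orbT.
  rewrite -lez_nat in le; rewrite !PoszD in ed *; lia.
move=> t; rewrite inE => /eqP ->; rewrite linE.
pose v (y : 'I_m) := if y == ys (kp y) then subx n (mdeg b) (kp y) else 0%N.
have mv : mdeg v = subx n (mdeg b).
  apply/funext => k; rewrite /mdeg; have [_ yk _] := ysP k.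
  rewrite (bigD1 (ys k)) ?yk //= big1 ?addn0; first by rewrite /v yk eqxx.
  by move=> y /andP[/eqP yk' /negPf ny]; rewrite /v yk' ny.
have wv : weight v = W (subx n (mdeg b)).
  rewrite /weight (partition_big kp predT) //=; apply: eq_bigr => k _.
  have [_ yk _] := ysP k.
  rewrite (bigD1 (ys k)) ?yk //= big1 ?addn0; first by rewrite /v yk eqxx mulnC.
  by move=> y /andP[/eqP yk' /negPf ny]; rewrite /v yk' ny.
exists (addx v b); split.
- split=> [y|y yF] /=; first exact: leq_addl.
  rewrite /addx /v; case: eqP => [yy|//]; have [ysF _ _] := ysP (kp y).
  by rewrite -yy (negPf yF) in ysF.
- by rewrite mdegD mv subxK.
- rewrite weightD wv -{1}(subxK bn) WD !PoszD.
  suff -> : forall x y z : int, x + y + (z - y + e0) - (x + z) = e0 by [].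
  by move=> x y z; lia.
Qed.

End Boxes.

(** * Initial degrees and prime annihilators *)

Section GradedPowers.
Variables (R : comPzRingType) (grR : nat -> {pred R}) (M : lmodType R).
Variables (grM : int -> {pred M}).
Hypotheses (rg : ring_grading grR) (mg : module_grading grR grM).
Variables (r : nat) (I : 'I_r -> submodClosed R^o).
Variables (m : nat) (kp : 'I_m -> 'I_r) (g : 'I_m -> R) (dl : 'I_m -> nat).
Hypothesis Igen : forall k, I k =i span_mod [set x : R^o | exists2 y, kp y = k & x = g y].
Hypothesis gdeg : forall y, g y \in grR (dl y).
Hypothesis nR : noetherian R.
Hypothesis M_fg : fin_gen (full_mod M).
Local Notation mon := (mon g).
Local Notation mdeg := (mdeg kp).
Local Notation weight := (weight dl).
Local Notation mspan := (mspan g).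
Local Notation lower := (lower kp g).
Local Notation lead := (lead kp g).
Local Notation pw := (pw I).
Implicit Types (P Q : submodClosed M) (n : 'I_r -> nat).
Let dsM : direct_sum grM. Proof. by case: mg. Qed.
Let fgM : forall A : submodClosed M, fin_gen A. Proof. exact: fin_gen_sub. Qed.

Lemma mon_gr a : mon a \in grR (weight a).
Proof.
have [_ gr1 grM'] := rg.
move: a; apply: exp_ind => [|y a IH].
  by rewrite mon0 /weight big1 // => i _; rewrite mul0n.
rewrite monD mon1 weightD; apply: grM' => //.
rewrite /weight (bigD1 y) //= big1 => [|i /negPf iy]; rewrite /onex ?iy ?mul0n //.
by rewrite eqxx mul1n addn0.
Qed.

Lemma mon_scale_gr a x e : x \in grM (e - (weight a)%:Z) -> mon a *: x \in grM e.
Proof. by move=> xe; have := mg.2 _ _ _ _ (mon_gr a) xe; rewrite addrC subrK. Qed.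

Lemma hcomp_mon a x e : hcomp grM (mon a *: x) e = mon a *: hcomp grM x (e - (weight a)%:Z).
Proof. exact: (hcomp_scale mg _ _ (mon_gr a)). Qed.

Lemma hclosed_mspan S Q : hclosed grM Q -> hclosed grM (mspan S Q).
Proof.
move=> hQ; apply: (hclosed_span rg mg) => _ [b [q [Sb Qq ->]]] e.
by rewrite hcomp_mon; apply: mem_mspan => //; exact: hQ.
Qed.

Lemma hclosed_pw n Q : hclosed grM Q -> hclosed grM (pw n Q).
Proof. by rewrite (pwE Igen); exact: hclosed_mspan. Qed.

(** The initial degrees of a multigraded module. Initial coefficients turn the
    nonvanishing in bidegree (n, d) into a condition on exponents of multidegree
    n, and a finite box decomposition makes this condition constant. *)
Lemma min_linear_graded Q (Z T : ('I_r -> nat) -> submodClosed M) :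
  hclosed grM Q -> rees I Z -> rees I T -> (forall n, hclosed grM (Z n)) ->
  (forall n, hclosed grM (T n)) -> (forall n, {subset Z n <= pw n Q}) ->
  (forall n, {subset T n <= Z n}) ->
  min_linear (fun n d => exists x, [/\ x \in grM d, x \in Z n & x \notin T n]).
Proof.
move=> hQ rZ rT hZ hT ZQ TZ; have [d0 d0P] := degree_bounded_below rg mg M_fg.
have st := stationary_pair (stationary_lead Igen fgM Q rZ) (stationary_lead Igen fgM Q rT).
have [l lP] := box_decomposition st.
pose D (B : ('I_m -> nat) * {set 'I_m}) : set int := [set e |
  (forall b, inbox B b -> (lead Q Z b, lead Q T b) = (lead Q Z B.1, lead Q T B.1)) /\
  exists x, [/\ x \in grM e, x \in lead Q Z B.1 & x \notin lead Q T B.1]].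
have hL a : hclosed grM (lower Q a) by exact: hclosed_mspan.
apply: (@min_linear_eq _ _ (fun n d => exists2 B, B \in l &
    exists a, [/\ inbox B a, mdeg a = n & D B (d - (weight a)%:Z)]) (fun=> 0%N)); last first.
  apply: min_linear_seq => B _; apply: (@min_linear_box _ _ _ _ _ _ d0) => e [_ [x [xe _ xT]]].
  by apply: d0P xe _; apply: contraNneq xT => ->; exact: rpred0.
move=> n d _; split=> [[x0 [x0d x0Z x0T]]|[B _ [a [aB ma [Bc [x [xe]]]]]]]; last first.
  rewrite -[lead Q Z B.1](congr1 fst (Bc a aB)) -[lead Q T B.1](congr1 snd (Bc a aB)).
  move=> /leadP[z zZ hz] xT.
  exists (hcomp grM z d); split; [exact: hcomp_in|by apply: hZ; rewrite -ma|].
  apply: contra xT => zT; apply/leadP; exists (hcomp grM z d); rewrite ?ma //.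
  have <- : hcomp grM (mon a *: x) d = mon a *: x.
    by rewrite (hcomp_id dsM _ (mon_scale_gr xe)) eqxx.
  by rewrite -hcompB //; exact: hL.
have [||a [x [q [ma [xd xZ xT] Qq xq amin]]]] := @minimal_leading_term _ _ _ _ kp g Igen _ Q n
    (fun x => [/\ x \in grM d, x \in Z n & x \notin T n]).
- by exists x0 => //; exact: ZQ.
- by case=> _ _; rewrite rpred0.
pose c := hcomp grM q (d - (weight a)%:Z).
have cd : mon a *: c \in grM d by apply: mon_scale_gr; exact: hcomp_in.
have xc : x - mon a *: c \in lower Q a.
  by have := hL a _ xq d; rewrite hcompB // hcomp_mon (hcomp_id dsM _ xd) eqxx.
have cZ : c \in lead Q Z a by apply/leadP; exists x; rewrite ?ma // -opprB rpredN.
have cT : c \notin lead Q T a.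
  apply/negP => /leadP[t tT ht]; rewrite ma in tT.
  have {}ht : mon a *: c - hcomp grM t d \in lower Q a.
    by have := hL a _ ht d; rewrite hcompB // (hcomp_id dsM _ cd) eqxx.
  have tT' : hcomp grM t d \in T n by exact: hT.
  have /amin/negP : [/\ x - hcomp grM t d \in grM d, x - hcomp grM t d \in Z n
      & x - hcomp grM t d \notin T n].
    split; first by apply: (grB dsM) => //; exact: hcomp_in.
      by rewrite submodB //; exact: TZ.
    by apply: contra xT => h; rewrite -[x](subrK (hcomp grM t d)) rpredD.
  apply; rewrite -[x](subrK (mon a *: c)) -addrA rpredD //.
have [B Bl [aB Bc]] := lP a; exists B => //; exists a; split=> //; split=> //.
exists c; rewrite -[lead Q Z B.1](congr1 fst (Bc a aB)).
by rewrite -[lead Q T B.1](congr1 snd (Bc a aB)); split=> //; exact: hcomp_in.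
Qed.

Lemma rees_pw P : rees I (fun n => pw n P).
Proof. by move=> k n; rewrite pwD pw1. Qed.

(** For p graded and x homogeneous, p is the annihilator of x if and only if p kills
    x and x survives in the localization at p; both conditions cut out graded
    families. A p that is not graded is not the annihilator of any
    homogeneous element. *)
Lemma min_linear_prime P Q p : prime_ideal p -> hclosed grM P -> hclosed grM Q ->
  min_linear (fun n d => exists x, [/\ x \in grM d, x \in pw n Q & colon_is (pw n P) x p]).
Proof.
move=> [p1 pp] hP hQ; have [dsR gr1 grMul] := rg.
have hJ n : hclosed grM (pw n P) by exact: hclosed_pw.
have [hp|nhp] := pselect (hclosed grR p); last first.
  apply: (@min_linear0 _ _ (fun=> 0%N)) => n d _ [x [xd _ xp]]; apply: nhp => c cp i.
  by rewrite xp; apply: (hcomp_ann rg mg) xd _ => //; rewrite -xp.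
pose Z n : submodClosed M := span_mod [set x | x \in pw n Q /\
  forall c : R, c \in p -> c *: x \in pw n P].
have ZP n x : x \in Z n <-> x \in pw n Q /\ forall c : R, c \in p -> c *: x \in pw n P.
  apply: span_closed; first by split=> [|c _]; rewrite ?scaler0; exact: rpred0.
  move=> b {}x y [xQ xp] [yQ yp]; split=> [|c cp]; first by rewrite rpredD ?rpredZ.
  by rewrite scalerDr scalerA mulrC -scalerA rpredD ?yp // rpredZ // xp.
(* The elements of Z n that vanish in the localization at p. The denominators s are
   homogeneous, which makes T n graded at once. *)
pose T n : submodClosed M := span_mod [set x | x \in Z n /\
  exists i (s : R), [/\ s \in grR i, s \notin p & s *: x \in pw n P]].
have TP n x : x \in T n <-> x \in Z n /\
    exists i (s : R), [/\ s \in grR i, s \notin p & s *: x \in pw n P].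
  apply: span_closed.
    split; first exact: rpred0.
    by exists 0%N, 1; split; rewrite // scaler0; exact: rpred0.
  move=> b {}x y [xZ [i [s [si sp sx]]]] [yZ [j [t [tj tp ty]]]].
  split; first by rewrite rpredD ?rpredZ.
  exists (i + j)%N, (s * t); split; first exact: grMul.
    by apply/negP => /pp[]; apply/negP.
  rewrite scalerDr rpredD //; last by rewrite -scalerA rpredZ.
  by rewrite scalerA mulrC [s * t]mulrC mulrA -scalerA rpredZ.
apply: (@min_linear_eq _ _
    (fun n d => exists x, [/\ x \in grM d, x \in Z n & x \notin T n]) (fun=> 0%N)); last first.
  apply: (@min_linear_graded Q).
  - exact: hQ.
  - move=> k n; apply: ideal_mul_sub => c x ck /ZP[xQ xp]; apply/ZP; split.
      by apply: rees_pw; exact: mem_ideal_mul.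
    move=> b bp; rewrite scalerA mulrC -scalerA.
    by apply: rees_pw; apply: mem_ideal_mul => //; exact: xp.
  - move=> k n; apply: ideal_mul_sub => c x ck /TP[/ZP[xQ xp] [i [s [si sp sx]]]].
    apply/TP; split.
      apply/ZP; split; first by apply: rees_pw; exact: mem_ideal_mul.
      move=> b bp; rewrite scalerA mulrC -scalerA.
      by apply: rees_pw; apply: mem_ideal_mul => //; exact: xp.
    exists i, s; split=> //; rewrite scalerA mulrC -scalerA.
    by apply: rees_pw; exact: mem_ideal_mul.
  - move=> n x /ZP[xQ xp] e; apply/ZP; split; first exact: hclosed_pw.
    move=> c cp; have [t [ut t0]] := hcomp_supp dsR c.
    rewrite (sum_hcomp dsR ut t0) scaler_suml; apply: submod_sum => i _.
    have -> : hcomp grR c i *: hcomp grM x e = hcomp grM (hcomp grR c i *: x) (e + i%:Z).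
      by rewrite (hcomp_scale mg _ _ (hcomp_in dsR c i)) addrK.
    by apply: hJ; apply: xp; exact: hp.
  - move=> n x /TP[xZ [i [s [si sp sx]]]] e; apply/TP; split.
      move: xZ => /ZP[xQ xp]; apply/ZP; split; first exact: hclosed_pw.
      move=> c cp; have [t [ut t0]] := hcomp_supp dsR c.
      rewrite (sum_hcomp dsR ut t0) scaler_suml; apply: submod_sum => j _.
      have -> : hcomp grR c j *: hcomp grM x e = hcomp grM (hcomp grR c j *: x) (e + j%:Z).
        by rewrite (hcomp_scale mg _ _ (hcomp_in dsR c j)) addrK.
      by apply: hJ; apply: xp; exact: hp.
    exists i, s; split=> //.
    have -> : s *: hcomp grM x e = hcomp grM (s *: x) (e + i%:Z).
      by rewrite (hcomp_scale mg _ _ si) addrK.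
    exact: hJ.
  - by move=> n x /ZP[].
  - by move=> n x /TP[].
move=> n d _; split=> [[x [xd xQ xp]]|[x [xd /ZP[xQ xp] xT]]]; exists x; split=> //.
- by apply/ZP; split=> // c; rewrite xp.
- by apply/negP => /TP[_ [i [s [_ /negP sp]]]]; rewrite -xp.
- move=> c; apply/idP/idP; first exact: xp.
  move=> cx; apply: contrapT => /negP cp; move/negP: xT; apply; apply/TP; split; first exact/ZP.
  have [i ip] : exists i, hcomp grR c i \notin p.
    apply: contrapT => h; move/negP: cp; apply; have [t [ut t0]] := hcomp_supp dsR c.
    rewrite (sum_hcomp dsR ut t0); apply: (@submod_sum R R^o) => i _.
    by apply: contrapT => /negP ip; apply: h; exists i.
  exists i, (hcomp grR c i); split=> //; first exact: hcomp_in.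
  exact: (hcomp_ann rg mg) xd cx.
Qed.

(** Replace x by a multiple with the same annihilator whose initial exponent, modulo
    I^n P, is as small as possible. Then the annihilator of its initial coefficient
    is again p, for otherwise the initial term of a further multiple could be
    cancelled. As initial coefficients take finitely many values, only finitely
    many primes occur for all n together. *)
Lemma Ass_lead P Q n x p : x \in pw n Q -> prime_ideal p -> colon_is (pw n P) x p ->
  exists a, Ass_mod (lead Q (fun n => pw n P) a) p.
Proof.
move=> xQ ppr xp; have [p1 pp] := ppr.
have [||a [z [q [ma [b [j [bp jJ zE]]] Qq zq amin]]]] :=
  @minimal_leading_term _ _ _ _ kp g Igen _ Q n
    (fun z => exists (b : R) j, [/\ b \notin p, j \in pw n P & z = b *: x + j]).
- by exists x => //; exists 1, 0; rewrite scale1r addr0 rpred0.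
- move=> [b [j [bp jJ /esym/eqP]]]; rewrite addr_eq0 => /eqP bx.
  by move/negP: bp; apply; rewrite xp bx rpredN.
exists a; split=> //; exists q => c; apply/idP/idP => [cp|/leadP[j' jJ' hj]].
  apply/leadP; exists (c *: z).
    rewrite ma zE scalerDr scalerA mulrC -scalerA rpredD //; last exact: rpredZ.
    by rewrite rpredZ // -xp.
  by rewrite scalerA mulrC -scalerA -scalerBr rpredZ // -opprB rpredN.
apply: contrapT => /negP cp.
have /amin/negP : exists (b : R) j, [/\ b \notin p, j \in pw n P & c *: z - j' = b *: x + j].
  exists (c * b), (c *: j - j'); split.
  - by apply/negP => /pp[]; apply/negP.
  - by rewrite submodB ?rpredZ // -ma.
  - by rewrite zE scalerDr scalerA addrA.
apply; have -> : c *: z - j' = c *: (z - mon a *: q) + (mon a *: (c *: q) - j').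
  by rewrite scalerBr !scalerA [c * _]mulrC addrA subrK.
by rewrite rpredD // rpredZ.
Qed.

Definition prime_degree P Q n d := exists x p,
  [/\ x \in grM d, x \in pw n Q, prime_ideal p & colon_is (pw n P) x p].

Lemma min_linear_prime_degree P Q : hclosed grM P -> hclosed grM Q -> min_linear (prime_degree P Q).
Proof.
move=> hP hQ; pose J n := pw n P.
have rJ : rees I J by exact: rees_pw.
have [l lP] := box_decomposition (stationary_lead Igen fgM Q rJ).
pose S := \bigcup_(B in [set` l]) Ass_mod (lead Q J B.1).
apply: (@min_linear_eq _ _ (fun n d => exists2 p, S p &
    exists x, [/\ x \in grM d, x \in pw n Q & colon_is (pw n P) x p]) (fun=> 0%N)).
  move=> n d _; split=> [[x [p [xd xQ ppr xp]]]|[p [B _ [ppr _]] [x [xd xQ xp]]]].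
    exists p; last by exists x.
    have [a pa] := Ass_lead xQ ppr xp; have [B Bl [aB Bc]] := lP a.
    by exists B => //; rewrite -(Bc a aB).
  by exists x, p.
apply: min_linear_finite => [|p [B _ [ppr _]]]; last exact: min_linear_prime.
by apply: bigcup_finite => [|B _]; [exact: finite_seq|exact: finite_Ass_mod].
Qed.

End GradedPowers.

(** * Artin-Rees and colon modules *)

Section Colons.
Variables (R : comPzRingType) (r : nat) (I : 'I_r -> submodClosed R^o).
Variables (m : nat) (kp : 'I_m -> 'I_r) (g : 'I_m -> R).
Hypothesis Igen : forall k, I k =i span_mod [set x : R^o | exists2 y, kp y = k & x = g y].
Variable M : lmodType R.
Hypothesis fgM : forall A : submodClosed M, fin_gen A.
Hypothesis nR : noetherian R.
Local Notation pw := (pw I).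
Implicit Types (B K Q N : submodClosed M) (n : 'I_r -> nat).

(** Beyond degree c in direction k, the intersections of B with I^n Q arise from one
    another by multiplication with I_k. *)
Lemma artin_rees B Q : exists c : nat, forall n x, x \in B -> x \in pw n Q ->
  x \in pw (subx n (fun=> c)) B.
Proof.
pose Z n : submodClosed M := span_mod [set x | x \in B /\ x \in pw n Q].
have ZP n x : x \in Z n <-> x \in B /\ x \in pw n Q by exact: mem_cap.
have [||c cP] := @rees_fin_gen _ _ _ _ _ _ Igen _ fgM Q Z.
- move=> k n; apply: ideal_mul_sub => a x ak /ZP[xB xQ]; apply/ZP.
  by rewrite rpredZ // pwD pw1 mem_ideal_mul.
- by move=> n x /ZP[].
exists c => n x xB xQ; have : x \in Z n by exact/ZP.
move: n x {xB xQ}; apply: exp_ind => [|k n IH] x.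
  by case/ZP=> xB _; rewrite (_ : subx _ _ = fun=> 0%N) ?pw0 //; apply/funext.
have [cn|nc] := leqP c (n k).
  have -> : subx (addx (onex k) n) (fun=> c) = addx (onex k) (subx n (fun=> c)).
    apply/funext => i; rewrite /subx /addx /onex; case: eqP => [->|//].
    by rewrite -addnBA.
  move=> /(cP k n cn) xZ; rewrite pwD pw1; apply: ideal_mulS xZ => //.
have -> : subx (addx (onex k) n) (fun=> c) = subx n (fun=> c).
  apply/funext => i; rewrite /subx /addx /onex; case: eqP => [->|//].
  by apply/eqP; rewrite add1n; move: nc; rewrite -!subn_eq0 => nc; lia.
move=> /ZP[xB xQ]; apply: IH; apply/ZP; split=> //; apply: pw_anti xQ => i.
exact: leq_addl.
Qed.

(** The Artin-Rees lemma, applied to one scalar after the other: an element which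
    all the given scalars carry deep into the filtration is itself deep, up to a
    common zero of the scalars. *)
Lemma colon_seq (bs : seq R) K : exists c : nat, forall n x, x \in K ->
  (forall b, b \in bs -> b *: x \in pw n (full_mod M)) ->
  exists2 w, w \in pw (subx n (fun=> c)) K & forall b, b \in bs -> b *: (x - w) = 0.
Proof.
elim: bs K => [|b bs IH] K.
  exists 0%N => n x xK _; exists 0; first exact: rpred0.
  by move=> b.
pose bK : submodClosed M := span_mod [set y | exists2 k, k \in K & y = b *: k].
have bKP n x : x \in pw n bK -> exists2 w, w \in pw n K & x = b *: w.
  move: x; apply: span_ind.
  - by exists 0; [exact: rpred0|rewrite scaler0].
  - move=> a _ _ [u uK ->] [v vK ->]; exists (a *: u + v); first by rewrite rpredD ?rpredZ.
    by rewrite scalerDr !scalerA mulrC.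
  - move=> _ [a [y [an + ->]]] => /span_closed[]; last first.
    + move=> k kK ->.
      by exists (a *: k); [exact: mem_ideal_mul|rewrite !scalerA mulrC].
    + move=> c _ _ [u uK ->] [v vK ->]; exists (c *: u + v); first by rewrite rpredD ?rpredZ.
      by rewrite scalerDr !scalerA mulrC.
    + by exists 0; [exact: rpred0|rewrite scaler0].
pose K' : submodClosed M := span_mod [set x | x \in K /\ b *: x = 0].
have K'P x : x \in K' <-> x \in K /\ b *: x = 0.
  apply: span_closed; first by split; [exact: rpred0|exact: scaler0].
  move=> a u v [uK ub] [vK vb]; split; first by rewrite rpredD ?rpredZ.
  by rewrite scalerDr vb addr0 scalerA mulrC -scalerA ub scaler0.
have [c cP] := artin_rees bK (full_mod M); have [c' c'P] := IH K'.
exists (c + c')%N => n x xK hx.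
have [w wK bxw] : exists2 w, w \in pw (subx n (fun=> c)) K & b *: x = b *: w.
  apply: bKP; apply: cP; last by apply: hx; exact: mem_head.
  by apply: mem_span; exists x.
have [||w' w'K hw'] := c'P (subx n (fun=> c)) (x - w).
- apply/K'P; rewrite scalerBr bxw subrr; split=> //.
  by rewrite submodB //; exact: pw_sub wK.
- move=> b' b'bs; rewrite scalerBr; apply: submodB; last first.
    by rewrite rpredZ //; apply: pw_mono wK.
  apply: (@pw_anti _ _ _ _ _ n); last by apply: hx; rewrite inE b'bs orbT.
  by move=> i; exact: leq_subr.
have K'K : {subset K' <= K} by move=> y /K'P[].
exists (w + w').
  rewrite rpredD //; first by apply: pw_anti wK => i; rewrite /subx leq_sub2l ?leq_addr.
  apply: (pw_mono K'K); apply: pw_anti w'K => i.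
  by rewrite /subx -subnDA.
move=> b'; rewrite inE opprD addrA => /orP[/eqP ->|/hw' //].
have /K'P[_ bw'] := pw_sub w'K.
by rewrite 2!scalerBr bxw subrr bw' subrr.
Qed.

(** A common zero of generators of I_k is 0, so [colon_seq] loses only a fixed
    number of powers. *)
Lemma colon_weak k : zero_colon M (I k) = [set 0] ->
  exists c : nat, forall n x, (forall a : R, a \in I k -> a *: x \in pw n (full_mod M)) ->
  x \in pw (subx n (fun=> c)) (full_mod M).
Proof.
move=> reg; have [t tP] := nR (I k); have [c cP] := colon_seq t (full_mod M).
exists c => n x hx; have [//|b bt|w wM hw] := cP n x.
  by apply: hx; rewrite tP; exact: mem_span.
suff /eqP : x - w = 0 by rewrite subr_eq0 => /eqP ->.
suff : zero_colon M (I k) (x - w) by rewrite reg.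
move=> a; rewrite tP; move: a; apply: (@span_ind R R^o).
- exact: scale0r.
- move=> a u v hu hv; rewrite [LHS](_ : _ = a *: ((u : R) *: (x - w)) + (v : R) *: (x - w)).
    by rewrite hu hv scaler0 addr0.
  by rewrite scalerA -scalerDl.
- by move=> b; exact: hw.
Qed.

(** For large n the colon by I_k undoes one multiplication by I_k. The weak form
    puts x into a fixed shift of the filtration of N, and the family of all such x is
    a submodule of the Rees module, hence generated by I_k in large degrees. *)
Lemma colon_power N s k : zero_colon M (I k) = [set 0] ->
  {subset pw s (full_mod M) <= N} ->
  exists T : 'I_r -> nat, forall n, cle T n -> forall x,
  (forall a : R, a \in I k -> a *: x \in pw n N) -> x \in pw (subx n (onex k)) N.
Proof.
move=> reg sN; have [c cP] := colon_weak reg.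
(* The shift e makes up for the loss c, for the s powers that carry M into N, and for
   the one power of I_k that is gained in the end. *)
pose e := addx (fun=> c) (addx s (onex k)).
pose Z n : submodClosed M := span_mod [set x | x \in pw n N /\
  forall a : R, a \in I k -> a *: x \in pw (addx n e) N].
have ZP n x : x \in Z n <-> x \in pw n N /\
    forall a : R, a \in I k -> a *: x \in pw (addx n e) N.
  apply: span_closed; first by split=> [|a _]; rewrite ?scaler0; exact: rpred0.
  move=> b u v [uN hu] [vN hv]; split=> [|a ak]; first by rewrite rpredD ?rpredZ.
  by rewrite scalerDr scalerA mulrC -scalerA rpredD ?hv // rpredZ // hu.
have [||c' c'P] := @rees_fin_gen _ _ _ _ _ _ Igen _ fgM N Z.
- move=> j n; apply: ideal_mul_sub => a x aj /ZP[xN hx]; apply/ZP; split.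
    by rewrite pwD pw1 mem_ideal_mul.
  move=> b bk; rewrite scalerA mulrC -scalerA -addxA pwD pw1.
  by apply: mem_ideal_mul => //; exact: hx.
- by move=> n x /ZP[].
exists (addx (addx (onex k) (fun=> c')) e) => n Tn x hx.
pose v := subx (subx n e) (onex k).
have en : cle e n by move=> i; apply: leq_trans (Tn i); exact: leq_addl.
have kn : cle (onex k) (subx n e).
  move=> i; rewrite /subx leq_subRL // addnC; apply: leq_trans (Tn i).
  by rewrite /addx leq_add2r leq_addr.
have nE : n = addx (addx (onex k) v) e by rewrite [addx (onex k) v]addxC !subxK.
have -> : subx n (onex k) = addx v e by rewrite nE -addxA addxC addxK.
have : x \in Z (addx (onex k) v).
  apply/ZP; split; last by rewrite -nE.
  apply: (pw_mono sN); rewrite -pwD.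
  have : x \in pw (subx n (fun=> c)) (full_mod M).
    by apply: cP => a ak; apply: pw_mono (hx a ak).
  apply: pw_anti => i; rewrite nE /e /subx /addx; lia.
have /c'P h : (c' <= v k)%N.
  have := Tn k; rewrite /v /subx /addx /onex eqxx; lia.
move=> /h; move: x {hx}; apply: ideal_mul_sub => a x ak /ZP[_]; exact.
Qed.

(** A product of elements of the I_k outside p, with the required exponents, would
    lie in p. *)
Lemma prime_mexp p n : prime_ideal p -> {subset ideal_mexp I n <= p} ->
  exists k, {subset I k <= p}.
Proof.
move=> ppr np; apply: contrapT => h.
have /choice[a aP] : forall k, exists a, a \in I k /\ a \notin p.
  move=> k; apply: contrapT => ha; apply: h; exists k => a ak.
  by apply: contrapT => /negP ap; apply: ha; exists a.
have : \prod_(k < r) (a k : R) ^+ n k \in p.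
  apply: np; rewrite /ideal_mexp; apply: (big_ind2 (fun (x : R) (A : submodClosed R^o) => x \in A)).
  - by [].
  - by move=> x A y B xA yB; exact: (@mem_ideal_mul R R^o).
  - move=> k _; elim: (n k) => [//|i IH]; rewrite exprS.
    by apply: (@mem_ideal_mul R R^o) => //; case: (aP k).
apply/negP; apply: (big_ind (fun x : R => x \notin p)).
- by case: ppr.
- by move=> x y xp yp; apply/negP => /ppr.2[]; apply/negP.
- by move=> k _; apply: prime_expr => //; case: (aP k).
Qed.

(** The annihilator p of x contains I^(n + s), hence some I_k, and then
    [colon_power] applies. *)
Lemma colon_prime N s : (forall k, zero_colon M (I k) = [set 0]) ->
  {subset pw s (full_mod M) <= N} ->
  exists T : 'I_r -> nat, forall n, cle T n -> forall x p,
  prime_ideal p -> colon_is (pw n N) x p ->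
  exists k, (0 < n k)%N /\ x \in pw (subx n (onex k)) N.
Proof.
move=> reg sN.
have /choice[T TP] : forall k, exists T : 'I_r -> nat, forall n, cle T n -> forall x,
    (forall a : R, a \in I k -> a *: x \in pw n N) -> x \in pw (subx n (onex k)) N.
  by move=> k; exact: colon_power (reg k) sN.
(* The sum bounds all T k at once; its successor makes n k positive. *)
exists (fun i => (\sum_k T k i).+1) => n Tn x p ppr xp.
have [k kp_] : exists k, {subset I k <= p}.
  apply: (@prime_mexp p (addx n s)) => // a an; rewrite xp.
  apply: (pw_mono sN); rewrite -pwD; exact: mem_ideal_mul.
exists k; split; first exact: leq_trans (Tn k).
apply: TP => [i|a /kp_]; last by rewrite xp.
by apply: leq_trans (Tn i); rewrite (bigD1 k) //= -addnS leq_addr.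
Qed.

End Colons.

(** * The v-number *)

Lemma infimum_min (d : Order.disp_t) (T : porderType d) (x0 m : T) (A : set T) :
  A m -> lbound A m -> infimum x0 A = m.
Proof.
move=> Am mA; rewrite /infimum; case: ifPn => [/eqP A0|_]; first by rewrite A0 in Am.
apply: xget_unique => [|y [yA yub]]; first by split=> // y; apply.
by apply/le_anti; rewrite (yA m Am) (yub m mA).
Qed.

Section VNumbers.
Variables (R : comPzRingType) (V : lmodType R) (gr : int -> {pred V}).
Variable E : int -> Prop.
Hypothesis EP : forall d, E d <->
  exists x p, [/\ x \in gr d, prime_ideal p & p =i ann x].

(** Primes that annihilate only inhomogeneous elements contribute infinity. *)
Lemma vnum_oo : (forall d, ~ E d) -> vnum gr = +oo%E.
Proof.
move=> E0; have loc p : Ass V p -> vnum_loc gr p = +oo%E.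
  move=> [ppr _]; rewrite /vnum_loc /infimum; case: ifPn => // /set0P[_ [d [x xd xp] _]].
  by case: (E0 d); apply/EP; exists x, p.
rewrite /vnum /infimum; case: ifPn => // /set0P[_ [p pA _]].
apply: (@xget_unique _ _ (infimums _)).
  split=> [_ [q qA <-]|y]; first by rewrite loc.
  by move=> _; exact: leey.
move=> y [_ yub]; apply/le_anti; rewrite leey /=; apply: yub => _ [q qA <-].
by rewrite loc.
Qed.

Lemma vnum_min d0 : E d0 -> (forall d, E d -> d0 <= d) -> vnum gr = d0%:E.
Proof.
move=> Ed0 d0min; apply: infimum_min.
  have /EP[x [p [xd ppr xp]]] := Ed0.
  exists p; first by split=> //; exists x.
  apply: infimum_min; first by exists d0 => //; exists x.
  move=> _ [d [y yd yp] <-]; rewrite lee_fin; apply: d0min.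
  by apply/EP; exists y, p.
move=> _ [p [ppr _] <-]; rewrite /vnum_loc.
set A := [set n : int | exists2 x, x \in gr n & p =i ann x].
have [A0|/set0P An0] := eqVneq A set0.
  by rewrite A0 image_set0 /infimum eqxx leey.
have Ad0 e : A e -> d0 <= e by move=> [x xe xp]; apply: d0min; apply/EP; exists x, p.
have [e Ae emin] := int_minimum An0 Ad0.
rewrite (@infimum_min _ _ _ e%:E); first by rewrite lee_fin Ad0.
  by exists e.
by move=> _ [f Af <-]; rewrite lee_fin emin.
Qed.

End VNumbers.

(** An empty list of linear functions gives the value infinity. *)
Lemma eventually_of_min_linear (R : comPzRingType) (r : nat)
    (V : ('I_r -> nat) -> lmodType R) (gr : forall n, int -> {pred V n}) E :
  min_linear E ->
  (forall n d, E n d <-> exists x p, [/\ x \in gr n d, prime_ideal p & p =i ann x]) ->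
  eventually_oo_or_min_linear (fun n => vnum (gr n)).
Proof.
move=> [l [N h]] EP; case: l h => [|t0 l] h.
  left; exists N => n Nn; apply: (vnum_oo (EP n)) => d Ed.
  by have [/(_ d Ed)[]] := h n Nn.
pose t (k : 'I_(size l).+1) := nth t0 (t0 :: l) k.
right; exists (size l), (fun k => (t k).1), (fun k => (t k).2), N => n Nn.
have [lo hi] := h n Nn.
have [k _ kE] := @eq_bigmin _ _ _ (+oo%E : \bar int) ord0 predT
  (fun k => (lin (t k) n)%:E) isT (fun i _ => leey _).
rewrite [RHS]kE; apply: (vnum_min (EP n)); first by apply: hi; exact: mem_nth.
move=> d /lo[u ul ud]; apply: le_trans ud; rewrite -lee_fin -kE.
have ui : (index u (t0 :: l) < (size l).+1)%N by rewrite index_mem.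
have <- : t (Ordinal ui) = u by exact: nth_index.
exact: (@bigmin_le _ (\bar int)).
Qed.

Section QuotientDegrees.
Variables (R : comPzRingType) (V : lmodType R) (gr : int -> {pred V}).
Implicit Types (A B : submodClosed V).

Lemma ann_quotmod B x (c : R) : (c \in ann (quotmod_pi B x)) = (c *: x \in B).
Proof.
rewrite -[LHS]/(c *: quotmod_pi B x == 0) -linearZ.
have <- : quotmod_pi B 0 = 0 by rewrite linear0.
by apply/eqP/idP => [/quotmod_piE|h]; [|apply/quotmod_piE]; rewrite subr0.
Qed.

Lemma quot_gr_prime B d :
  (exists x p, [/\ x \in quot_gr B gr d, prime_ideal p & p =i ann x]) <->
  exists x p, [/\ x \in gr d, prime_ideal p & colon_is B x p].
Proof.
split=> [[u [p [/asboolP[x xd ->] ppr up]]]|[x [p [xd ppr xp]]]].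
  by exists x, p; split=> // c; rewrite up ann_quotmod.
exists (quotmod_pi B x), p; split=> //; first by apply/asboolP; exists x.
by move=> c; rewrite ann_quotmod.
Qed.

End QuotientDegrees.

Lemma subquot_gr_prime (R : comPzRingType) (V : lmodType R) (gr : int -> {pred V})
    (A B : submodClosed V) d :
  (exists x p, [/\ x \in subquot_gr A B gr d, prime_ideal p & p =i ann x]) <->
  exists x p, [/\ x \in gr d, x \in A, prime_ideal p & colon_is B x p].
Proof.
apply: (iff_trans (@quot_gr_prime _ _ _ (restr_mod A B) d)).
split=> [[u [p [ud ppr up]]]|[x [p [xd xA ppr xp]]]].
  exists (val u), p; split=> //; first exact: valP.
exists (SubmodOf xA), p; split=> //.
Qed.

(** * The theorem *)

Lemma homogeneous_generator_family (R : comPzRingType) (grR : nat -> {pred R}) r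
    (I : 'I_r -> submodClosed R^o) : noetherian R -> ring_grading grR ->
  (forall k, homogeneous grR (I k)) ->
  exists m (kp : 'I_m -> 'I_r) (g : 'I_m -> R) (dl : 'I_m -> nat),
    (forall k, I k =i span_mod [set x : R^o | exists2 y, kp y = k & x = g y]) /\
    forall y, g y \in grR (dl y).
Proof.
move=> nR rg hI.
have /choice[s sP] := fun k => homogeneous_generators nR rg (hI k).
pose l := [seq (k, p) | k <- enum 'I_r, p <- s k].
have lP y : (tnth (in_tuple l) y).2 \in s (tnth (in_tuple l) y).1.
  by have /allpairsPdep[k [p [_ ps ->]]] := mem_tnth y (in_tuple l).
exists (size l), (fun y => (tnth (in_tuple l) y).1), (fun y => (tnth (in_tuple l) y).2.1),
  (fun y => (tnth (in_tuple l) y).2.2); split=> [k x|y]; last first.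
  by have [h _] := sP (tnth (in_tuple l) y).1; exact: h.
have [_ ->] := sP k; apply/idP/idP; apply: span_mono => a.
  move=> [p ps ->]; have /tnthP[y yE] : (k, p) \in in_tuple l.
    by apply/allpairsPdep; exists k, p; rewrite mem_enum.
  by exists y; rewrite -yE.
by move=> [y <- ->]; exists (tnth (in_tuple l) y).2.
Qed.

Theorem corollary1p6
    (R : comPzRingType) (grR : nat -> {pred R}) (M : lmodType R)
    (grM : int -> {pred M}) (N : submodClosed M)
    (r : nat) (I : 'I_r -> submodClosed R^o)
    (R_noeth : noetherian R)
    (R_graded : ring_grading grR)
    (M_fg : fin_gen (full_mod M))
    (M_graded : module_grading grR grM)
    (N_graded : homogeneous grM N)
    (I_homog : forall k, homogeneous grR (I k)) :
  eventually_oo_or_min_linear (fun n =>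
    vnum (subquot_gr (ideal_mul (ideal_mexp I n) (full_mod M))
                     (ideal_mul (ideal_mexp I n) N) grM))
  /\
  ((forall k, zero_colon M (I k) = [set 0]) ->
   (exists s : 'I_r -> nat,
      {subset ideal_mul (ideal_mexp I s) (full_mod M) <= N}) ->
   eventually_oo_or_min_linear (fun n =>
     vnum (quot_gr (ideal_mul (ideal_mexp I n) N) grM))).
Proof.
have [m [kp [g [dl [Igen gdeg]]]]] := homogeneous_generator_family R_noeth R_graded I_homog.
have hN : hclosed grM N by apply: homogeneous_hclosed N_graded; case: M_graded.
split=> [|reg [s sN]].
  apply: (@eventually_of_min_linear _ _ _ _ (prime_degree grM I N (full_mod M))).
    exact: (min_linear_prime_degree R_graded M_graded Igen gdeg).
  by move=> n d; apply: iff_sym; exact: subquot_gr_prime.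
apply: (@eventually_of_min_linear _ _ _ _ (fun n d => exists x p,
    [/\ x \in grM d, prime_ideal p & colon_is (pw I n N) x p])); last first.
  by move=> n d; apply: iff_sym; exact: quot_gr_prime.
have [T TP] := colon_prime Igen (fin_gen_sub R_noeth M_fg) R_noeth reg sN.
have shiftN n k : (0 < n k)%N -> pw I (subx n (onex k)) (ideal_mul (I k) N) = pw I n N.
  by move=> nk; rewrite -pw1 -pwD subxK //; exact: cle_onex.
(* By [colon_prime] an element with prime annihilator modulo I^n N lies in some
   I^(n - e_k) N, and I^n N is I^(n - e_k) (I_k N). *)
apply: (@min_linear_eq _ _ (fun n d => exists2 k, k \in enum 'I_r & (0 < n k)%N /\
    prime_degree grM I (ideal_mul (I k) N) N (subx n (onex k)) d) T).
  move=> n d Tn; split=> [[x [p [xd ppr xp]]]|[k _ [nk [x [p [xd xN ppr]]]]]].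
    have [k [nk xN]] := TP n Tn x p ppr xp; exists k; rewrite ?mem_enum //.
    by split=> //; exists x, p; split=> //; rewrite shiftN.
  by rewrite shiftN // => xp; exists x, p.
apply: min_linear_seq => k _; apply: min_linear_shift.
apply: (min_linear_prime_degree R_graded M_graded Igen gdeg) => //.
by rewrite -pw1; exact: (hclosed_pw R_graded M_graded Igen gdeg).
Qed.
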